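(* Let $\lambda_h=u_h|_{\partial\mathcal T_H}$ and let $\lambda_h^{\rm ms}\in\Lambda_h^{\rm ms}$ be the solution of $$s(\lambda_h^{\rm ms},\mu_h^{\rm ms})=(\rho g,T\mu_h^{\rm ms})\quad\text{for all }\mu_h^{\rm ms}\in\Lambda_h^{\rm ms}.$$ Set $u_h^{\mathbb H}=T\lambda_h$ and $u_h^{\rm ms}=T\lambda_h^{\rm ms}$. Then $\lambda_h-\lambda_h^{\rm ms}\in\widetilde\Lambda_h$ and $$|u_h^{\mathbb H}-u_h^{\rm ms}|_{H^1_{\mathcal A}(\Omega)}\le c_{P,L}\,H\,\|g\|_{L^2_\rho(\Omega)}.$$
   Context: Setting. $\Omega\subset\mathbb R^2$ is an open bounded domain with polygonal boundary; $\mathcal A\in[L^\infty(\Omega)]^{2\times2}_{\rm sym}$ satisfies, for a.e. $x\in\Omega$ and all $v\in\mathbb R^2$, $a_{\min}|v|^2\le a_-(x)|v|^2\le\mathcal A(x)v\cdot v\le a_+(x)|v|^2\le a_{\max}|v|^2$, where $a_{\min},a_{\max}>0$ are constants and $a_-(x),a_+(x)$ are the smallest and largest eigenvalues of $\mathcal A(x)$. $\rho\in L^\infty(\Omega)$ with $\rho(x)\in[\rho_{\min},\rho_{\max}]$ a.e., for positive constants $\rho_{\min},\rho_{\max}$. $f\in L^2(\Omega)$ is given and $g$ is defined by $f=\rho g$. $(\cdot,\cdot)$ is the $L^2(\Omega)$ inner product, $a(v,w)=\int_\Omega\mathcal A\nabla v\cdot\nabla w\,dx$, $\|v\|_{L^2_\rho(D)}=\|\rho^{1/2}v\|_{L^2(D)}$,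 $|v|_{H^1_{\mathcal A}(D)}=\|\mathcal A^{1/2}\nabla v\|_{L^2(D)}$. Meshes. $\mathcal T_H$ is a regular finite element partition of $\Omega$ into triangles of characteristic length $H>0$, with skeleton $\partial\mathcal T_H$ (union of element boundaries). For $h<H$, $\mathcal T_h$ is a refinement of $\mathcal T_H$ (every edge of $\mathcal T_H$ is a union of edges of $\mathcal T_h$). $\mathcal N_H$ is the set of nodes of $\mathcal T_H$ on $\partial\mathcal T_H\setminus\partial\Omega$. Spaces. $V_h\subset H^1_0(\Omega)$: continuous piecewise linear functions on $\mathcal T_h$. $u_h\in V_h$ solves $a(u_h,v_h)=(\rho g,v_h)$ for all $v_h\in V_h$. $V_h^B=\{v_h\in V_h: v_h=0\text{ on }\partial\tau\ \forall\tau\in\mathcal T_H\}$; $V_h^{\mathbb H}=\{u\in V_h:a(u,v)=0\ \forall v\in V_h^B\}$; $\Lambda_h=\{v_h|_{\partial\mathcal T_H}:v_h\in V_h^{\mathbb H}\}$. $T:\Lambda_h\to V_h^{\mathbb H}$ is the discrete harmonic extension: $(T\mu_h)|_{\partial\mathcal T_H}=\mu_h$ and $a(T\mu_h,v_h^B)=0$ for all $v_h^B\in V_h^B$. $s_\tau(\mu_h,\nu_h)=\int_\tau\mathcal A\nabla T\mu_h\cdot\nabla T\nu_h\,dx$ and $s=\sum_{\tau\in\mathcal T_H}s_\tau$. $\widetilde\Lambda_h=\{\tilde\lambda_h\in\Lambda_h:\tilde\lambda_h(x_i)=0\ \forall x_i\in\mathcal N_H\}$. $\Lambda_h^{\rm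 ms}\subset\Lambda_h$ is the $s$-orthogonal complement of $\widetilde\Lambda_h$ in $\Lambda_h$, so $\Lambda_h=\widetilde\Lambda_h\oplus\Lambda_h^{\rm ms}$. Local Poincaré constant. $c_{P,L}=\max_{\tau\in\mathcal T_H}c_{P,L}^\tau$, where $c_{P,L}^\tau$ is the smallest constant such that $\|T\tilde\mu_h\|_{L^2_\rho(\tau)}\le c_{P,L}^\tau H|T\tilde\mu_h|_{H^1_{\mathcal A}(\tau)}$ for all $\tilde\mu_h\in\widetilde\Lambda_h$. *)

(* Defs.v *)
From HB Require Import structures.
From mathcomp Require Import all_boot all_order all_algebra.
From mathcomp Require Import all_classical all_reals all_analysis.

Set Implicit Arguments.
Unset Strict Implicit.
Unset Printing Implicit Defensive.

Import Order.TTheory GRing.Theory Num.Theory.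
Import numFieldNormedType.Exports.

Local Open Scope classical_set_scope.
Local Open Scope ring_scope.

Notation pt R := (R * R)%type.

(* The plane as the measurable space (Borel sigma-algebra) on which Lebesgue
   measure is defined; it is convertible to [pt R]. *)
Notation mpt R := (measurableTypeR R * measurableTypeR R)%type.

Definition leb2 (R : realType) : {measure set (mpt R) -> \bar R} :=
  (@lebesgue_measure R \x @lebesgue_measure R)%E.

Section Geometry.
Context {R : realType}.

Definition bdry (D : set (pt R)) : set (pt R) := closure D `\` interior D.

Definition segment (p q : pt R) : set (pt R) :=
  [set (1 - t) *: p + t *: q | t in [set t : R | 0 <= t <= 1]].

Definition polygonal_domain (D : set (pt R)) : Prop :=
  [/\ open D, connected D, D !=set0, bounded_set D &
      exists s : seq (pt R * pt R),
        bdry D = \bigcup_(e in [set e | e \in s]) segment e.1 e.2].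

(* The normed-module structure on R * R carries the sup norm. *)
Definition edist (x y : pt R) : R :=
  Num.sqrt ((x.1 - y.1) ^+ 2 + (x.2 - y.2) ^+ 2).

(* The three vertices. *)
Definition triangle := 'I_3 -> pt R.

Definition nondegenerate (K : triangle) : Prop :=
  forall w : 'I_3 -> R, \sum_i w i = 0 -> \sum_i w i *: K i = 0 ->
    forall i, w i = 0.

Definition hull (K : triangle) : set (pt R) :=
  [set x | exists w : 'I_3 -> R,
     [/\ forall i, 0 <= w i, \sum_i w i = 1 & x = \sum_i w i *: K i]].

Definition edge_of (K : triangle) : set (set (pt R)) :=
  [set E | exists i j : 'I_3, i != j /\ E = segment (K i) (K j)].

Definition tri_bdry (K : triangle) : set (pt R) := \bigcup_(E in edge_of K) E.

Definition mesh (N : nat) := 'I_N -> triangle.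

(* Conforming partition of D.  Requiring the open triangles to lie in D makes
   bdry D part of the skeleton even where D lies on both sides of bdry D.
   Shape-regularity of one finite mesh of nondegenerate triangles is automatic. *)
Definition is_mesh (D : set (pt R)) N (T : mesh N) : Prop :=
  [/\ forall i, nondegenerate (T i),
      closure D = \bigcup_i hull (T i),
      forall i, interior (hull (T i)) `<=` D &
      forall i j, i != j ->
        [\/ hull (T i) `&` hull (T j) = set0,
            exists k l, T i k = T j l /\
              hull (T i) `&` hull (T j) = [set T i k]
          | exists E, [/\ edge_of (T i) E, edge_of (T j) E &
              hull (T i) `&` hull (T j) = E]]].

(* Any upper bound of the element diameters is accepted as a characteristic
   length, in particular the maximal diameter. *)
Definition char_length N (T : mesh N) (H : R) : Prop :=
  0 < H /\ forall i x y, hull (T i) x -> hull (T i) y -> edist x y <= H.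

Definition refines N n (Tf : mesh n) (Tc : mesh N) : Prop :=
  (forall k, exists i, hull (Tf k) `<=` hull (Tc i)) /\
  (forall i E, edge_of (Tc i) E ->
     exists S : set (set (pt R)),
       S `<=` \bigcup_k edge_of (Tf k) /\ E = \bigcup_(F in S) F).

Definition skeleton N (T : mesh N) : set (pt R) := \bigcup_i tri_bdry (T i).

Definition inner_nodes (D : set (pt R)) N (T : mesh N) : set (pt R) :=
  [set x | (exists i k, x = T i k) /\ (skeleton T `\` bdry D) x].

End Geometry.
Arguments triangle : clear implicits.
Arguments mesh : clear implicits.

Section Analysis.
Context {R : realType}.
Local Notation mu := (leb2 R).
Implicit Types (D : set (pt R)) (v w f g : pt R -> R) (A : pt R -> 'M[R]_2).

Definition dotv (x y : 'cV[R]_2) : R := (x^T *m y) 0 0.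

Definition smallest_eigenvalue (M : 'M[R]_2) (a : R) : Prop :=
  eigenvalue M a /\ forall b, eigenvalue M b -> a <= b.

Definition largest_eigenvalue (M : 'M[R]_2) (a : R) : Prop :=
  eigenvalue M a /\ forall b, eigenvalue M b -> b <= a.

Definition mfun_on D f : Prop := measurable_fun (D : set (mpt R)) f.

Definition Linfty D f : Prop :=
  mfun_on D f /\
  exists M : R, {ae mu, forall x, D x -> `|f x| <= M}.

Definition L2 D f : Prop :=
  mfun_on D f /\ mu.-integrable D (fun x => (f x ^+ 2)%:E).

Definition admissible_matrix D A (amin amax : R) : Prop :=
  [/\ 0 < amin, 0 < amax,
      forall i j, Linfty D (fun x => A x i j),
      {ae mu, forall x, D x -> (A x)^T = A x} &
      {ae mu, forall x, D x -> exists am ap : R,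
         [/\ smallest_eigenvalue (A x) am, largest_eigenvalue (A x) ap &
             forall v : 'cV[R]_2,
               [/\ amin * dotv v v <= am * dotv v v,
                   am * dotv v v <= dotv (A x *m v) v,
                   dotv (A x *m v) v <= ap * dotv v v &
                   ap * dotv v v <= amax * dotv v v]]}].

Definition admissible_weight D (rho : pt R -> R) (rmin rmax : R) : Prop :=
  [/\ 0 < rmin, 0 < rmax, Linfty D rho &
      {ae mu, forall x, D x -> rmin <= rho x <= rmax}].

(* The positive semidefinite square root (0 if there is none). *)
Definition sqrtmx (M : 'M[R]_2) : 'M[R]_2 :=
  xget 0 [set S : 'M[R]_2 |
    [/\ S^T = S, forall v : 'cV_2, 0 <= dotv (S *m v) v & S *m S = M]].

(* For a piecewise linear function this is the weak gradient: the partial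
   derivatives exist off the (null) edges of the mesh. *)
Definition grad v (x : pt R) : 'cV[R]_2 :=
  \col_(i < 2) (if i == 0 then 'D_(1, 0) v x else 'D_(0, 1) v x).

Definition inner D f g : R := \int[mu]_(x in D) (f x * g x).

Definition energy D A v w : R :=
  \int[mu]_(x in D) dotv (A x *m grad v x) (grad w x).

Definition normL2 D f : R := Num.sqrt (\int[mu]_(x in D) (f x ^+ 2)).

Definition normL2w D (rho : pt R -> R) f : R :=
  normL2 D (fun x => Num.sqrt (rho x) * f x).

Definition seminormH1 D A v : R :=
  Num.sqrt (\int[mu]_(x in D)
    dotv (sqrtmx (A x) *m grad v x) (sqrtmx (A x) *m grad v x)).

End Analysis.

Section Spaces.
Context {R : realType} (Omega : set (pt R)) (A : pt R -> 'M[R]_2).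
Context {N n : nat} (TH : mesh R N) (Th : mesh R n).
Implicit Types (v w mu nu : pt R -> R).

Definition affine_on (D : set (pt R)) v : Prop :=
  exists a b c : R, forall x, D x -> v x = a + b * x.1 + c * x.2.

(* Functions of H^1_0 are identified with their extension by zero; the last
   condition includes the homogeneous Dirichlet condition on the boundary. *)
Definition Vh : set (pt R -> R) :=
  [set v | [/\ {within closure Omega, continuous v},
               forall k, affine_on (hull (Th k)) v &
               forall x, ~ Omega x -> v x = 0]].

Definition VhB : set (pt R -> R) :=
  [set v | Vh v /\ forall i x, tri_bdry (TH i) x -> v x = 0].

Definition VhH : set (pt R -> R) :=
  [set u | Vh u /\ forall v, VhB v -> energy Omega A u v = 0].

(* The restriction to the skeleton is encoded as a function on the plane that
   vanishes off the skeleton. *)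
Definition trace v : pt R -> R := v \_ (skeleton TH).

Definition Lambda : set (pt R -> R) := [set trace v | v in VhH].

(* The discrete harmonic extension (relevant on Lambda only). *)
Definition ext mu : pt R -> R := xget (cst 0) [set v | VhH v /\ trace v = mu].

(* Elements are open in integrals over them, so as to stay inside Omega,
   where the coefficients live. *)
Definition elt (i : 'I_N) : set (pt R) := interior (hull (TH i)).

Definition s_loc (i : 'I_N) mu nu : R := energy (elt i) A (ext mu) (ext nu).

Definition s_form mu nu : R := \sum_(i < N) s_loc i mu nu.

Definition Lambda_tilde : set (pt R -> R) :=
  [set mu | Lambda mu /\ forall x, inner_nodes Omega TH x -> mu x = 0].

Definition Lambda_ms : set (pt R -> R) :=
  [set mu | Lambda mu /\ forall nu, Lambda_tilde nu -> s_form mu nu = 0].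

(* Without 0 <= c there would be no smallest constant when Lambda_tilde is
   trivial on the element. *)
Definition cPL_loc (rho : pt R -> R) (H : R) (i : 'I_N) : R :=
  inf [set c : R | 0 <= c /\ forall mu, Lambda_tilde mu ->
    normL2w (elt i) rho (ext mu) <= c * H * seminormH1 (elt i) A (ext mu)].

Definition cPL (rho : pt R -> R) (H : R) : R :=
  \big[Num.max/0]_(i < N) cPL_loc rho H i.

End Spaces.

(* Main.v *)
Require Import Defs.
From HB Require Import structures.
From mathcomp Require Import all_boot all_order all_algebra.
From mathcomp Require Import all_classical all_reals all_analysis.
From mathcomp Require Import measurable_realfun.
From mathcomp Require Import ring lra zify.

(* The a-orthogonal projection of u_h along the bubble space V_h^B has the same
   trace as u_h and is therefore u_h^H.  For mu in Lambda^ms both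
   s(lambda_h, mu) and s(lambda_h^ms, mu) equal (rho g, T mu), so the component
   of lambda_h - lambda_h^ms in Lambda^ms is s-orthogonal to itself and vanishes.
   Hence d = u_h^H - u_h^ms is the extension of an element of Lambda~, and
   a(d, d) = (rho g, d) <= |g|_rho |d|_rho <= c_PL H |g|_rho a(d, d)^(1/2).

   As the infimum of the empty set is 0, the constant c_PL is meaningful only
   because each element has a finite Poincare constant: a function whose trace is
   in Lambda~ and whose gradient vanishes on an element is constant there, and it
   is 0 at the vertices, which lie on the boundary of Omega or in N_H.

   Gradients are unspecified on the edges of the mesh, and the coefficients are
   controlled only almost everywhere, so every integral is first reduced to a
   measurable conull part of Omega on which all hypotheses hold pointwise. *)

Set Implicit Arguments.
Unset Strict Implicit.
Unset Printing Implicit Defensive.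

Import Order.TTheory GRing.Theory Num.Theory.
Import numFieldNormedType.Exports.

Local Open Scope classical_set_scope.
Local Open Scope ring_scope.

(* mathcomp has a homonym on bilinear forms. *)
Local Notation nondegenerate := Defs.nondegenerate.

(** * Semi-inner products on finitely spanned subspaces *)

Section SemiInner.
Context {R : realType} {V : lmodType R}.
Implicit Types (W Z : set V) (B P Q : V -> V -> R) (s : seq V).

Definition linear_set W : Prop :=
  W 0 /\ forall (a : R) u v, W u -> W v -> W (a *: u + v).

(** Linearity is asked only on [W], because the energy integrals are bilinear on finite element
    functions only. Degenerate forms are included: the energy of one element is zero for a function
    constant on that element. *)
Definition semi_inner W B : Prop :=
  [/\ forall (a : R) u v w, W u -> W v -> W w ->
        B (a *: u + v) w = a * B u w + B v w,
      forall u v, W u -> W v -> B u v = B v u &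
      forall u, W u -> 0 <= B u u].

(** Generators are peeled off one at a time, which suits induction; they may be linearly
    dependent. *)
Fixpoint lin_span s : set V :=
  if s is w :: l then [set v | exists a z, lin_span l z /\ v = a *: w + z]
  else [set 0].

Lemma semi_innerS W Z B : Z `<=` W -> semi_inner W B -> semi_inner Z B.
Proof.
move=> ZW [h1 h2 h3]; split=> *; [apply: h1|apply: h2|apply: h3]; exact: ZW.
Qed.

Lemma linear_set_sub W u v : linear_set W -> W u -> W v -> W (u - v).
Proof.
by move=> [_ h] Wu Wv; rewrite -[_ - _]addrC -scaleN1r; exact: h.
Qed.

Lemma lin_span_linear s : linear_set (lin_span s).
Proof.
elim: s => [|w l [h0 h]] /=.
  by split=> //= a u v -> ->; rewrite scaler0 addr0.
split=> [|a u v [b [z [lz ->]]] [c [y [ly ->]]]].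
  by exists 0, 0; split=> //; rewrite scale0r addr0.
exists (a * b + c), (a *: z + y); split; first exact: h.
by rewrite scalerDr scalerA scalerDl addrACA.
Qed.

Section Inner.
Variables (W : set V) (B : V -> V -> R).
Hypotheses (lW : linear_set W) (sB : semi_inner W B).

Lemma semi_innerDr a u v w : W u -> W v -> W w ->
  B w (a *: u + v) = a * B w u + B w v.
Proof.
case: sB => h1 h2 _ Wu Wv Ww.
by rewrite h2 ?h1 1?(h2 u w) 1?(h2 v w)//; exact: lW.2.
Qed.

Lemma semi_inner0l w : W w -> B 0 w = 0.
Proof.
case: sB => h1 _ _ Ww; have := h1 1 0 0 w lW.1 lW.1 Ww.
rewrite scale1r addr0 mul1r; lra.
Qed.

Lemma semi_innerBl u v w : W u -> W v -> W w -> B (u - v) w = B u w - B v w.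
Proof.
case: sB => h1 _ _ Wu Wv Ww.
by rewrite [u - v]addrC -scaleN1r h1// mulN1r addrC.
Qed.

Lemma semi_inner_quad a u v : W u -> W v ->
  B (a *: u + v) (a *: u + v) = a ^+ 2 * B u u + 2 * a * B u v + B v v.
Proof.
case: sB => h1 h2 _ Wu Wv.
have Wz : W (a *: u + v) by exact: lW.2.
by rewrite h1// !semi_innerDr// (h2 v u)//; ring.
Qed.

Lemma semi_inner_CS u v : W u -> W v -> B u v ^+ 2 <= B u u * B v v.
Proof.
move=> Wu Wv; case: sB => _ _ h3.
have q a : 0 <= a ^+ 2 * B u u + 2 * a * B u v + B v v.
  by rewrite -semi_inner_quad//; apply: h3; exact: lW.2.
have Bu := h3 _ Wu; have Bv := h3 _ Wv.
move: Bu; rewrite le_eqVlt => /predU1P[Bu0|Bu].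
  rewrite -Bu0 mul0r; have [->|Buv] := eqVneq (B u v) 0; first by rewrite expr0n.
  (* When [B u u = 0] the quadratic is affine in [a], and this choice would give it the value -1. *)
  have := q (- (B v v + 1) / (2 * B u v)); rewrite -Bu0 mulr0 add0r.
  have -> : 2 * (- (B v v + 1) / (2 * B u v)) * B u v = - (B v v + 1) by field.
  by lra.
(* The minimizer of the quadratic. *)
have := q (- B u v / B u u).
have -> : (- B u v / B u u) ^+ 2 * B u u + 2 * (- B u v / B u u) * B u v + B v v
  = (B u u * B v v - B u v ^+ 2) / B u u by field; rewrite gt_eqF.
by rewrite ler_pdivlMr// mul0r subr_ge0.
Qed.

Lemma semi_inner_null u v : W u -> W v -> B u u = 0 -> B u v = 0.
Proof.
move=> Wu Wv Bu; apply/eqP; rewrite -sqrf_eq0 eq_le sqr_ge0 andbT.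
by rewrite (le_trans (semi_inner_CS Wu Wv))// Bu mul0r.
Qed.

(** Gram-Schmidt for a possibly degenerate form: [v] and the first generator [w] are projected on
    the span of the others, and the result for [v] is corrected along the residual [w - p]. *)
Lemma span_projection s v : lin_span s `<=` W -> W v ->
  exists2 w, lin_span s w & forall z, lin_span s z -> B (v - w) z = 0.
Proof.
elim: s v => [|w l IH] v sW Wv.
  exists 0 => // z /= ->; rewrite subr0; case: (sB) => _ h2 _.
  by rewrite h2 ?semi_inner0l//; exact: lW.1.
have lS : lin_span l `<=` W.
  by move=> z lz; apply: sW; exists 0, z; rewrite scale0r add0r.
have Ww : W w.
  apply: sW; exists 1, 0; rewrite scale1r addr0; split=> //.
  exact: (lin_span_linear l).1.
have [p lp hp] := IH w lS Ww; have [q lq hq] := IH v lS Wv.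
case: (sB) => h1 h2 h3.
have Wp := lS _ lp; have Wq := lS _ lq.
have Wwp : W (w - p) by exact: linear_set_sub.
pose c := B (v - q) (w - p) / B (w - p) (w - p).
exists (c *: (w - p) + q).
  exists c, (q - c *: p); split; last by rewrite scalerBr addrAC addrA.
  rewrite addrC -scaleNr; apply: (lin_span_linear l).2 => //.
move=> _ [a [z [lz ->]]].
have -> : a *: w + z = a *: (w - p) + (a *: p + z).
  by rewrite scalerBr -addrA (addrA (- _)) addNr add0r.
have lpz : lin_span l (a *: p + z) by exact: (lin_span_linear l).2.
have Wpz := lS _ lpz.
have Wvq : W (v - q) by exact: linear_set_sub.
have -> : v - (c *: (w - p) + q) = (- c) *: (w - p) + (v - q).
  by rewrite opprD addrCA scaleNr.
rewrite semi_innerDr//; last exact: lW.2.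
rewrite !h1// (hp _ lpz) (hq _ lpz) mulr0 !addr0.
(* A residual of zero norm is orthogonal to all of [W] by Cauchy-Schwarz, so any value of [c]
   works. *)
have [B0|Bn0] := eqVneq (B (w - p) (w - p)) 0.
  by rewrite B0 [B (v - q) _]h2// semi_inner_null// !mulr0 addr0 mulr0.
have -> : - c * B (w - p) (w - p) + B (v - q) (w - p) = 0.
  by rewrite /c; field.
by rewrite mulr0.
Qed.

End Inner.

(** Induction on the generators. Replacing the new generator by its [Q]-orthogonal residual [u]
    makes [Q] additive, while [P] at a sum is at most twice the sum of the two values of [P]. *)
Lemma span_domination W P Q s : linear_set W -> semi_inner W P ->
  semi_inner W Q -> lin_span s `<=` W ->
  (forall v, W v -> Q v v = 0 -> P v v = 0) ->
  exists2 c, 0 <= c & forall v, lin_span s v -> P v v <= c * Q v v.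
Proof.
move=> lW sP sQ + QP; elim: s => [|w l IH] sW.
  exists 0 => // _ ->; rewrite mul0r (semi_inner0l lW sP)//; exact: lW.1.
have lS : lin_span l `<=` W.
  by move=> z lz; apply: sW; exists 0, z; rewrite scale0r add0r.
have Ww : W w.
  apply: sW; exists 1, 0; rewrite scale1r addr0; split=> //.
  exact: (lin_span_linear l).1.
have [p lp hp] := span_projection lW sQ lS Ww.
have [c c0 hc] := IH lS; have Wp := lS _ lp.
have Wu : W (w - p) by exact: linear_set_sub.
set u := w - p in hp Wu.
case: (sP) => P1 P2 P3; case: (sQ) => Q1 Q2 Q3.
have Pu := P3 _ Wu; have Qu := Q3 _ Wu.
have [d d0 hd] : exists2 d, 0 <= d & P u u <= d * Q u u.
  move: Qu; rewrite le_eqVlt => /predU1P[Q0|Qu].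
    by exists 0 => //; rewrite mul0r QP.
  by exists (P u u / Q u u); [rewrite divr_ge0// ltW|rewrite divfK ?gt_eqF].
exists (2 * (d + c)); first lra.
move=> _ [a [z [lz ->]]].
have -> : a *: w + z = a *: u + (a *: p + z).
  by rewrite scalerBr -addrA (addrA (- _)) addNr add0r.
have ly : lin_span l (a *: p + z) by exact: (lin_span_linear l).2.
move: (a *: p + z) ly => y ly; have Wy := lS _ ly.
rewrite (semi_inner_quad lW sP)// (semi_inner_quad lW sQ)// (hp _ ly).
rewrite mulr0 addr0.
(* Nonnegativity of [P] at [y - a u] bounds the mixed term; the factor 2 in the constant comes from
   here. *)
have hP : 0 <= a ^+ 2 * P u u - 2 * a * P u y + P y y.
  have := P3 _ (lW.2 (- a) _ _ Wu Wy); rewrite (semi_inner_quad lW sP)//.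
  by rewrite sqrrN mulrN mulNr.
have Qy := Q3 _ Wy; have a2 := sqr_ge0 a.
have := ler_wpM2l a2 hd; have := mulr_ge0 c0 (mulr_ge0 a2 Qu).
have := mulr_ge0 d0 Qy; have := hc _ ly; lra.
Qed.

(** The kernel of one functional has codimension at most one in [W], so each functional contributes
    at most one generator. *)
Lemma separated_span (I : eqType) (L : I -> V -> R) (r : seq I) W :
  linear_set W ->
  (forall i (a : R) u v, W u -> W v -> L i (a *: u + v) = a * L i u + L i v) ->
  (forall v, W v -> (forall i, i \in r -> L i v = 0) -> v = 0) ->
  exists s, W = lin_span s.
Proof.
elim: r W => [|i r IH] W lW hL sep.
  exists [::]; apply/seteqP; split=> v /=; first by move=> Wv; apply: sep.
  by move=> ->; exact: lW.1.
pose W' := W `&` [set v | L i v = 0].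
have L0 j : L j 0 = 0.
  by have := hL j 1 0 0 lW.1 lW.1; rewrite scale1r addr0 mul1r; lra.
have lW' : linear_set W'.
  split=> [|a u v [Wu /= u0] [Wv v0]]; first by split; [exact: lW.1|exact: L0].
  by split; [exact: lW.2|rewrite /= hL// u0 v0 mulr0 addr0].
have [||s sE] := IH W' lW'.
- by move=> j a u v [Wu _] [Wv _]; exact: hL.
- move=> v [Wv v0] h; apply: sep => // j; rewrite inE => /predU1P[->//|]; exact: h.
have [[w [Ww w0]]|nw] := pselect (exists w, W w /\ L i w <> 0); last first.
  exists s; rewrite -sE; apply/seteqP; split=> [v Wv|v []//]; split=> //=.
  by apply: contrapT => v0; apply: nw; exists v.
exists (w :: s); apply/seteqP; split=> v /=; rewrite -sE; last first.
  by move=> [a [z [[Wz _] ->]]]; exact: lW.2.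
move=> Wv; exists (L i v / L i w), (v - (L i v / L i w) *: w); split; last first.
  by rewrite addrC subrK.
rewrite addrC -scaleNr; split; first exact: lW.2.
by rewrite /= hL// mulNr divfK ?addNr//; exact/eqP.
Qed.

End SemiInner.

(** * Barycentric coordinates *)

Section Barycentric.
Context {R : realType}.
Implicit Types (K : triangle R) (x y : pt R) (w : 'I_3 -> R).

Lemma fst_lincomb w K : (\sum_i w i *: K i).1 = \sum_i w i * (K i).1.
Proof.
by rewrite (big_morph (fun z : pt R => z.1) (id1 := 0) (op1 := +%R)).
Qed.

Lemma snd_lincomb w K : (\sum_i w i *: K i).2 = \sum_i w i * (K i).2.
Proof.
by rewrite (big_morph (fun z : pt R => z.2) (id1 := 0) (op1 := +%R)).
Qed.

(** A row of weights times this matrix lists the total weight and the two coordinates of the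
    weighted sum of vertices, so nondegeneracy says that the left kernel is trivial. *)
Definition vertex_mx K : 'M[R]_3 :=
  \matrix_(i, j) [:: 1; (K i).1; (K i).2]`_j.

(** Entry [j] of the row [(1, x.1, x.2)] times the inverse vertex matrix, written out as an affine
    function of [x]. *)
Definition bary K (j : 'I_3) x : R :=
  invmx (vertex_mx K) 0 j + invmx (vertex_mx K) 1 j * x.1
  + invmx (vertex_mx K) 2%:R j * x.2.

Lemma vertex_mx_unit K : nondegenerate K -> vertex_mx K \in unitmx.
Proof.
move=> ndK; rewrite -row_free_unit -kermx_eq0; apply/rowV0P => v.
move=> /sub_kermxP vM; apply/rowP => i; rewrite mxE.
have E j : \sum_k v 0 k * vertex_mx K k j = 0.
  by move/rowP/(_ j): vM; rewrite !mxE.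
apply: (ndK (fun i => v 0 i)).
  rewrite -[RHS](E 0); apply: eq_bigr => k _; by rewrite mxE /= mulr1.
rewrite [LHS]surjective_pairing fst_lincomb snd_lincomb.
have := E 1; have := E 2%:R.
under eq_bigr do rewrite mxE /=.
move=> E2; under eq_bigr do rewrite mxE /=.
by move=> E1; rewrite E1 E2.
Qed.

Lemma bary_spec K x : nondegenerate K ->
  \sum_j bary K j x = 1 /\ x = \sum_j bary K j x *: K j.
Proof.
move=> /vertex_mx_unit MU.
pose r : 'rV[R]_3 := \row_j [:: 1; x.1; x.2]`_j.
have bE j : (r *m invmx (vertex_mx K)) 0 j = bary K j x.
  rewrite mxE !big_ord_recl big_ord0 !mxE /= mul1r addr0 addrA /bary.
  rewrite [x.1 * _]mulrC [x.2 * _]mulrC.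
  have -> : lift ord0 ord0 = 1 :> 'I_3 by exact: val_inj.
  by have -> : lift ord0 (lift ord0 ord0) = 2%:R :> 'I_3 by exact: val_inj.
have E j : \sum_k bary K k x * vertex_mx K k j = r 0 j.
  rewrite -[in RHS](mulmxKV MU r) [RHS]mxE.
  by apply: eq_bigr => k _; rewrite bE.
split.
  have := E 0; rewrite [RHS]mxE /= => <-.
  by apply: eq_bigr => k _; rewrite mxE /= mulr1.
rewrite [RHS]surjective_pairing fst_lincomb snd_lincomb [LHS]surjective_pairing.
congr pair.
  have := E 1; rewrite [RHS]mxE /= => <-.
  by apply: eq_bigr => k _; rewrite mxE /=.
have := E 2%:R; rewrite [RHS]mxE /= => <-.
by apply: eq_bigr => k _; rewrite mxE /=.
Qed.

Lemma bary_unique K w : nondegenerate K -> \sum_i w i = 1 ->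
  forall j, bary K j (\sum_i w i *: K i) = w j.
Proof.
move=> ndK w1 j; set x := \sum_i _; have [b1 bx] := bary_spec x ndK.
apply/eqP; rewrite -subr_eq0; apply/eqP.
apply: (ndK (fun i => bary K i x - w i)).
  by rewrite big_split /= sumrN b1 w1 subrr.
under eq_bigr do rewrite scalerBl.
by rewrite big_split /= sumrN -bx subrr.
Qed.

Lemma hullE K : nondegenerate K ->
  hull K = [set x | forall j, 0 <= bary K j x].
Proof.
move=> ndK; apply/seteqP; split=> x /=.
  by move=> [w [w0 w1 ->]] j; rewrite bary_unique.
by move=> b0; exists (bary K ^~ x); have [] := bary_spec x ndK.
Qed.

Lemma affine_comb a b c w K : \sum_i w i = 1 ->
  a + b * (\sum_i w i *: K i).1 + c * (\sum_i w i *: K i).2 =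
  \sum_i w i * (a + b * (K i).1 + c * (K i).2) :> R.
Proof.
move=> w1; rewrite fst_lincomb snd_lincomb !mulr_sumr -{1}[a]mul1r -w1 mulr_suml.
by rewrite -!big_split; apply: eq_bigr => i _ /=; ring.
Qed.

Lemma bary_vertex K i j : nondegenerate K -> bary K j (K i) = (i == j)%:R.
Proof.
move=> ndK; have -> : K i = \sum_k (i == k)%:R *: K k.
  rewrite (bigD1 i)//= eqxx scale1r big1 ?addr0// => k ki.
  by rewrite eq_sym (negbTE ki) scale0r.
rewrite bary_unique// (bigD1 i)//= eqxx big1 ?addr0// => k ki.
by rewrite eq_sym (negbTE ki).
Qed.

Lemma bary_line K j x y t :
  bary K j ((1 - t) *: x + t *: y) = (1 - t) * bary K j x + t * bary K j y.
Proof.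
rewrite /bary; rewrite /= /GRing.scale /=; ring.
Qed.

Lemma bary_segment K i j x t : nondegenerate K ->
  bary K j ((1 - t) *: x + t *: K i) = (1 - t) * bary K j x + t * (i == j)%:R.
Proof. by move=> ndK; rewrite bary_line bary_vertex. Qed.

Lemma affine_continuous (a b c : R) :
  continuous (fun x : pt R => a + b * x.1 + c * x.2).
Proof.
move=> x; apply: cvgD; last by apply: cvgMr; exact: cvg_snd.
by apply: cvgD; [exact: cvg_cst|apply: cvgMr; exact: cvg_fst].
Qed.

Lemma bary_continuous K j : continuous (bary K j).
Proof. exact: affine_continuous. Qed.

Lemma open_bary_gt0 K : open [set x | forall j, 0 < bary K j x].
Proof.
rewrite openE => x xP; suff : \forall y \near x, forall j, 0 < bary K j y by [].
apply: (filter_forall (F := nbhs x)) => j.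
apply: open_nbhs_nbhs; split; last exact: xP.
apply: (@open_comp _ _ (bary K j) [set r | 0 < r]) => [y _|].
  exact: bary_continuous.
exact: open_gt.
Qed.

Lemma interior_hullE K : nondegenerate K ->
  interior (hull K) = [set x | forall j, 0 < bary K j x].
Proof.
move=> ndK; apply/seteqP; split=> x; last first.
  move=> xP; suff : nbhs x (hull K) by [].
  have : nbhs x [set x | forall j, 0 < bary K j x].
    by apply: open_nbhs_nbhs; split=> //; exact: open_bary_gt0.
  by apply: filterS => y yP; rewrite hullE// => j; exact/ltW.
move=> xi j; rewrite lt_neqAle; have := interior_subset xi.
rewrite hullE// => /(_ j) ->; rewrite andbT eq_sym; apply/eqP => b0.
have cont : (fun t : R => (1 - t) *: x + t *: K j) t @[t --> (0:R)] --> x.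
  rewrite -[X in _ --> X](_ : (1 - 0) *: x + 0 *: K j = x); last first.
    by rewrite subr0 scale1r scale0r addr0.
  apply: cvgD; apply: cvgZr_tmp; last exact: cvg_id.
  by apply: cvgB; [exact: cvg_cst|exact: cvg_id].
have := cont _ xi; rewrite /= => -[e /= e0 he].
(* The negative parameter moves [x] away from vertex [j], which makes the vanishing coordinate
   negative. *)
have : hull K ((1 - - (e / 2)) *: x + - (e / 2) *: K j).
  by apply: he; rewrite /= sub0r opprK ger0_norm; lra.
by rewrite hullE// => /(_ j); rewrite bary_segment// b0 eqxx mulr0 add0r mulr1; lra.
Qed.

End Barycentric.

(** * Lebesgue measure of the plane *)

Section PlaneMeasure.
Context {R : realType}.
Local Notation mu := (leb2 R).
Implicit Types (D : set (pt R)) (x : pt R).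

Lemma open_box D x : open D -> D x -> exists2 e : R, 0 < e &
  forall y, `|x.1 - y.1| < e -> `|x.2 - y.2| < e -> D y.
Proof.
move=> oD Dx; have : nbhs x D by exact: open_nbhs_nbhs.
by rewrite -nbhs_ballE => -[e /= e0 h]; exists e => // y h1 h2; apply: h; split.
Qed.

(** The sigma-algebra is a product, so [D] is written as the countable union of the rational boxes
    that it contains. *)
Lemma measurable_open2 D : open D -> measurable (D : set (mpt R)).
Proof.
move=> oD.
pose box (q : rat * rat * (rat * rat)) : set (mpt R) :=
  `]ratr q.1.1, ratr q.1.2[%classic `*` `]ratr q.2.1, ratr q.2.2[%classic.
have -> : (D : set (mpt R)) =
    \bigcup_q (if pselect (box q `<=` D) then box q else set0).
  apply/seteqP; split=> x; last by case=> q _; case: (pselect (box q `<=` D)) => [h /h//|//].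
  move=> Dx; have [e e0 he] := open_box oD Dx.
  have r (z : R) : exists2 p : rat * rat,
      z - e < ratr p.1 < z & z < ratr p.2 < z + e.
    have /rat_in_itvoo[p] : z - e < z by lra.
    rewrite in_itv /= => hp.
    have /rat_in_itvoo[q] : z < z + e by lra.
    by rewrite in_itv /= => hq; exists (p, q).
  have [p hp1 hp2] := r x.1; have [q hq1 hq2] := r x.2.
  exists (p, q) => //; case: (pselect (box (p, q) `<=` D)) => [_|[]] /=.
    by rewrite /box /= !in_itv /=; split; lra.
  move=> y [/=]; rewrite !in_itv /= => h1 h2; apply: he.
    by rewrite ltr_norml; lra.
  by rewrite ltr_norml; lra.
apply: countable_bigcupT_measurable => // q; case: (pselect (box q `<=` D)) => ?.
  by apply: measurableX; exact: measurable_itv.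
exact: measurable0.
Qed.

Lemma leb2_itv (a b c d : R) :
  mu (`]a, b[%classic `*` `]c, d[%classic) =
  (lebesgue_measure `]a, b[%classic * lebesgue_measure `]c, d[%classic)%E.
Proof. exact: (product_measure1E lebesgue_measure lebesgue_measure). Qed.

Lemma leb2_open_gt0 D : open D -> D !=set0 -> (0 < mu D)%E.
Proof.
move=> oD [x Dx]; have [e e0 he] := open_box oD Dx.
pose B : set (mpt R) := `]x.1 - e, x.1 + e[%classic `*` `]x.2 - e, x.2 + e[%classic.
apply: (@lt_le_trans _ _ (mu B)).
  rewrite leb2_itv !lebesgue_measure_itv /= !lte_fin.
  have -> : x.1 - e < x.1 + e by lra.
  have -> : x.2 - e < x.2 + e by lra.
  by rewrite -!EFinB -EFinM lte_fin mulr_gt0; lra.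
apply: le_measure; rewrite ?inE.
- by apply: measurableX; exact: measurable_itv.
- exact: measurable_open2.
- move=> y [/=]; rewrite !in_itv /= => h1 h2; apply: he; rewrite ltr_norml; lra.
Qed.

Lemma leb2_bounded_fin D : open D -> bounded_set D -> (mu D < +oo)%E.
Proof.
(* [M] may be negative, and only numbers strictly above it are known to bound the norm; hence the
   maximum with 0 and the intermediate bound [m] below. *)
move=> oD [M [_ hM]]; pose e := Num.max M 0 + 1.
pose B : set (mpt R) := `]-e, e[%classic `*` `]-e, e[%classic.
have e0 : 0 < e by rewrite ltr_pwDr// le_max lexx orbT.
apply: (@le_lt_trans _ _ (mu B)); last first.
  rewrite leb2_itv !lebesgue_measure_itv /= !lte_fin.
  have -> : - e < e by lra.
  by rewrite -!EFinB -EFinM ltry.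
apply: le_measure; rewrite ?inE.
- exact: measurable_open2.
- by apply: measurableX; exact: measurable_itv.
move=> x Dx; pose m := Num.max M 0 + 1 / 2.
have MM : M <= Num.max M 0 by rewrite le_max lexx.
have Mm : M < m by rewrite /m; lra.
have := hM _ Mm _ Dx; rewrite /= prod_normE ge_max => /andP[h1 h2].
have me : m < e by rewrite /m /e; lra.
by rewrite /B /= !in_itv /= -!ltr_norml; split; lra.
Qed.

(** A vertical line is a point times the real line; the vertical sections of any other line are
    single points. *)
Lemma leb2_line (a b c : R) : (b, c) != (0, 0) ->
  mu [set x | a + b * x.1 + c * x.2 = 0] = 0%E.
Proof.
have [->|c0 _] := eqVneq c 0.
  rewrite xpair_eqE eqxx andbT => b0.
  have -> : [set x : mpt R | a + b * x.1 + 0 * x.2 = 0] =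
      [set - a / b] `*` setT.
    apply/seteqP; split=> -[x y] /=; rewrite mul0r addr0.
      by move=> h; split=> //; apply: (mulfI b0); rewrite [RHS]mulrC divfK//; lra.
    by case=> -> _; field.
  have := product_measure1E lebesgue_measure lebesgue_measure
    (measurable_set1 (- a / b)) (@measurableT _ (measurableTypeR R)).
  by rewrite [X in (X * _)%E]lebesgue_measure_set1 mul0e.
rewrite /leb2 /product_measure1 /=; apply: integral0_eq => x _ /=.
have -> : xsection [set z : mpt R | a + b * z.1 + c * z.2 = 0] x =
    [set - (a + b * x) / c].
  apply/seteqP; split=> y; rewrite /xsection /= inE /=.
    by move=> h; apply: (mulfI c0); rewrite [RHS]mulrC divfK//; lra.
  by move=> ->; field.
exact: lebesgue_measure_set1.
Qed.

Lemma measurable_affine D (a b c : R) :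
  measurable_fun (D : set (mpt R)) (fun x : pt R => a + b * x.1 + c * x.2).
Proof.
apply: (@measurable_funS _ _ _ _ setT) => //.
apply: measurable_funD; first apply: measurable_funD => //.
  by apply: measurable_funM => //; exact: measurable_fst.
by apply: measurable_funM => //; exact: measurable_snd.
Qed.

Lemma measurable_continuous2 (v : pt R -> R) : continuous v ->
  measurable_fun [set: mpt R] v.
Proof.
move=> cv; apply: (measurability _ (RGenOInfty.measurableE R)).
move=> _ [_ [a ->] <-]; rewrite setTI; apply: measurable_open2.
apply: (@open_comp _ _ v) => [y _|]; first exact: cv.
by rewrite set_itvoy; exact: open_gt.
Qed.

End PlaneMeasure.

(** * Integrals of possibly non-measurable functions *)

Section NullSets.
Import HBNNSimple.
Context d {T : measurableType d} {R : realType} (mu : {measure set T -> \bar R}).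
Variable Z : set T.
Hypotheses (mZ : measurable Z) (Z0 : mu Z = 0%E).

Let ge0_le_off_null (F G : T -> \bar R) :
  (forall x, 0 <= F x)%E -> (forall x, 0 <= G x)%E ->
  (forall x, ~ Z x -> F x = G x) -> (\int[mu]_x F x <= \int[mu]_x G x)%E.
Proof.
move=> F0 G0 FG; rewrite !ge0_integralTE//.
apply: ge_ereal_sup => _ [h /= hF <-].
have mZc : measurable (~` Z) by exact: measurableC.
have -> : sintegral mu h = sintegral mu (proj_nnsfun h mZc).
  have -> : sintegral mu h = (\int[mu]_x (h x)%:E)%E.
    by rewrite integral_nnsfun// patch_setT.
  rewrite (ge0_negligible_integral mZ measurableT) ?setTD//.
  - by rewrite integral_nnsfun// mrestrict.
  - exact/measurable_EFinP.
  - by move=> x _; rewrite lee_fin.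
apply: ereal_sup_ubound; exists (proj_nnsfun h mZc) => // x.
rewrite -mrestrict patchE; case: ifPn => // xZ.
by rewrite -FG//; move: xZ; rewrite inE.
Qed.

(* No measurability of [f], [g], [D] or [E] is needed: a simple function below
   the integrand can be cut off on the null set. *)
Lemma Rintegral_off_null (D E : set T) (f g : T -> R) :
  (forall x, ~ Z x -> (f \_ D) x = (g \_ E) x) ->
  \int[mu]_(x in D) f x = \int[mu]_(x in E) g x.
Proof.
move=> fg; rewrite Rintegral_mkcond [RHS]Rintegral_mkcond /Rintegral.
rewrite integralE [in RHS]integralE.
by congr (fine (_ - _)); apply/eqP; rewrite eq_le; apply/andP; split;
  apply: ge0_le_off_null => // x xZ; rewrite !(funeposE, funenegE) fg.
Qed.

Lemma Rintegral_setI_off_null (D E : set T) (f : T -> R) :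
  D `\` E `<=` Z -> \int[mu]_(x in D) f x = \int[mu]_(x in D `&` E) f x.
Proof.
move=> DEZ; apply: Rintegral_off_null => x nZ; rewrite !patchE in_setI.
have [xD|//] := boolP (x \in D); have [//|xE] := boolP (x \in E).
by exfalso; apply: nZ; apply: DEZ; split; [exact/set_mem|by move: xE; rewrite notin_setE].
Qed.

End NullSets.

(** * Additivity of the integral over a finite partition *)

Section BoundedIntegrands.
Context d {T : measurableType d} {R : realType} (mu : {measure set T -> \bar R}).

Lemma Rintegral_partition (I : finType) (F : I -> set T) (D : set T) (f : T -> R) :
  measurable D -> (forall i, measurable (F i)) ->
  (forall i j, i != j -> F i `&` F j = set0) -> D `<=` \bigcup_i F i ->
  mu.-integrable D (EFin \o f) ->
  \int[mu]_(x in D) f x = \sum_i \int[mu]_(x in F i `&` D) f x.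
Proof.
move=> mD mF tF DF fint.
have -> : \int[mu]_(x in D) f x =
    \int[mu]_(x in D) (\sum_i (f \_ (F i)) x).
  apply: eq_Rintegral => x /set_mem /[dup] Dx /DF [i _ Fix].
  rewrite (bigD1 i)//= patchE mem_set// big1 ?addr0// => j ji.
  rewrite patchE memNset// => Fjx; have := tF _ _ ji.
  by move/seteqP => -[/(_ x) h _]; exact: h.
have intF i : mu.-integrable D (EFin \o (f \_ (F i))).
  rewrite -restrict_EFin; apply/integrable_restrict => //.
  by apply: integrableS fint => //; exact: measurableI.
rewrite /Rintegral; under eq_integral do rewrite -sumEFin.
rewrite integral_sum// -sum_fine; last first.
  by move=> i _; exact: (integrable_fin_num mD (intF i)).
apply: eq_bigr => i _; congr fine; rewrite setIC integral_mkcondr.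
by rewrite restrict_EFin.
Qed.

End BoundedIntegrands.

(** * Triangles and meshes *)

Section FiniteElements.
Context {R : realType}.
Implicit Types (K : triangle R) (x y z : pt R) (v w : pt R -> R).

Lemma sum_third : \sum_(i < 3) (3^-1 : R) = 1.
Proof. by rewrite !big_ord_recl big_ord0; field. Qed.

Definition centroid K : pt R := \sum_i (3^-1 : R) *: K i.

Lemma bary_centroid K j : nondegenerate K -> bary K j (centroid K) = 3^-1.
Proof. by move=> ndK; rewrite /centroid bary_unique// sum_third. Qed.

Lemma interior_hull_neq0 K : nondegenerate K -> interior (hull K) !=set0.
Proof.
move=> ndK; exists (centroid K); rewrite interior_hullE// => j.
by rewrite bary_centroid// invr_gt0.
Qed.

Lemma hull_vertex K i : nondegenerate K -> hull K (K i).
Proof. by move=> ndK; rewrite hullE// => j; rewrite bary_vertex// ler0n. Qed.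

Lemma interior_hull_segment K x i t : nondegenerate K ->
  interior (hull K) x -> 0 <= t < 1 ->
  interior (hull K) ((1 - t) *: x + t *: K i).
Proof.
move=> ndK; rewrite interior_hullE// => xK /andP[t0 t1] j.
rewrite bary_segment// ltr_wpDr ?mulr_ge0// mulr_gt0//; lra.
Qed.

Lemma segment_continuous x y : continuous (fun t : R => (1 - t) *: x + t *: y).
Proof.
move=> t; apply: cvgD; apply: cvgZr_tmp; last exact: cvg_id.
by apply: cvgB; [exact: cvg_cst|exact: cvg_id].
Qed.

(** A point of the triangle becomes interior as soon as it is moved towards the centroid, and a
    small move stays in [U]. *)
Lemma hull_meets_interior K y (U : set (pt R)) : nondegenerate K ->
  hull K y -> open U -> U y -> (U `&` interior (hull K)) !=set0.
Proof.
move=> ndK Ky oU Uy.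
have : \forall t \near (0 : R), U ((1 - t) *: y + t *: centroid K).
  have := @segment_continuous y (centroid K) 0.
  rewrite /continuous_at subr0 scale1r scale0r addr0; apply.
  exact: open_nbhs_nbhs.
move=> [e /= e0 he]; pose t := Num.min (e / 2) (1 / 2).
have t0 : 0 < t by rewrite lt_min; apply/andP; split; lra.
have t1 : t <= 1 / 2 by rewrite ge_min lexx orbT.
have te : t <= e / 2 by rewrite ge_min lexx.
exists ((1 - t) *: y + t *: centroid K); split.
  by apply: he; rewrite /= sub0r normrN gtr0_norm//; lra.
rewrite interior_hullE// => j; rewrite bary_line bary_centroid//.
move: Ky; rewrite hullE// => /(_ j) b0.
by rewrite ltr_wpDl ?mulr_ge0 ?mulr_gt0 ?invr_gt0//; lra.
Qed.

(** Two distinct triangles share at most a vertex or an edge, where some barycentric coordinate is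
    zero; at an interior point all of them are positive. *)
Lemma disjoint_elements (D : set (pt R)) N (T : mesh R N) i j x :
  is_mesh D T -> interior (hull (T i)) x -> interior (hull (T j)) x -> i = j.
Proof.
move=> [nd _ _ conf] xi xj; apply: contrapT => /eqP ij.
have bi k : 0 < bary (T i) k x by move: xi; rewrite interior_hullE.
have hij : (hull (T i) `&` hull (T j)) x.
  by split; exact: interior_subset.
case: (conf i j ij) => [h0|[k [l [_ hE]]]|[E [[a [b [ab ->]]] _ hE]]].
- by rewrite h0 in hij.
- rewrite hE in hij; move: hij => /= xk.
  pose m : 'I_3 := if k == 0 then 1 else 0.
  have km : k != m by rewrite /m; case: (eqVneq k 0) => [->|].
  by have := bi m; rewrite xk bary_vertex// (negbTE km) ltxx.
- rewrite hE in hij; case: hij => t _ xE.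
  (* The vertex opposite to the common edge. *)
  have [m ma mb] : exists2 m : 'I_3, a != m & b != m.
    have : (0 < #|[set~ a] :\ b|)%N.
      have := cardsD1 b [set~ a]; rewrite cardsC1 card_ord; lia.
    by case/card_gt0P => m; rewrite !inE => /andP[mb ma];
      exists m; rewrite eq_sym.
  have := bi m; rewrite -xE bary_segment// bary_vertex//.
  by rewrite (negbTE ma) (negbTE mb) !mulr0 addr0 ltxx.
Qed.

(** What the interior misses lies on the three lines where a barycentric coordinate is zero. *)
Lemma ae_interior_hull K : nondegenerate K ->
  {ae leb2 R, forall x, hull K x -> interior (hull K) x}.
Proof.
move=> ndK; have line j : {ae leb2 R, forall x, bary K j x != 0}.
  exists [set x | bary K j x = 0]; split.
  - rewrite [X in measurable X](_ : _ = setT `&` bary K j @^-1` [set 0]).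
      exact: measurable_affine.
    by rewrite setTI.
  (* A constant coordinate could not be 1 at vertex [j] and 0 at another vertex. *)
  - apply: leb2_line; apply/eqP => -[b0 c0].
    pose k : 'I_3 := if j == 0 then 1 else 0.
    have jk : (k == j) = false.
      by rewrite /k; case: (eqVneq j 0) => [->|/negbTE]//; rewrite eq_sym.
    have := bary_vertex k j ndK; have := bary_vertex j j ndK.
    by rewrite /bary b0 c0 !mul0r !addr0 eqxx jk => ->; apply/eqP/oner_neq0.
  - by move=> x /= /negP; rewrite negbK => /eqP.
have := @filter_forall _ _ _ _ (ae_filter_ringOfSetsType (leb2 R)) line.
apply: filterS => x h; rewrite interior_hullE// hullE// => b0 j.
by rewrite lt_neqAle eq_sym h b0.
Qed.

Lemma grad_affine v x (a b c : R) :
  (\forall y \near x, v y = a + b * y.1 + c * y.2) ->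
  grad v x = \col_(i < 2) (if i == 0 then b else c).
Proof.
move=> vE; have D (e : pt R) : 'D_e v x = b * e.1 + c * e.2.
  rewrite (near_eq_derive _ vE); apply: cvg_lim => //.
  apply: cvg_near_cst; near=> t.
  have t0 : t != 0 by near: t; exact: nbhs_dnbhs_neq.
  rewrite /= /shift /= /GRing.scale /=; by field.
apply/colP => i; rewrite !mxE !D /=.
by case: ifP; rewrite !(mulr0, mulr1, addr0, add0r).
Unshelve. all: by end_near. Qed.

Lemma avoid_finite (s : seq R) (a b : R) : a < b ->
  exists2 c, a < c < b & c \notin s.
Proof.
elim: s a b => [|d s IH] a b ab; first by exists ((a + b) / 2) => //; lra.
have [dab|dab] := boolP (a < d < b).
  have [c cab cs] := IH a d (proj1 (andP dab)).
  exists c; first by lra.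
  by rewrite inE negb_or cs andbT; apply/eqP => cd; lra.
have [c cab cs] := IH a b ab; exists c => //.
by rewrite inE negb_or cs andbT; apply: contraNneq dab => <-.
Qed.

(** Otherwise the intermediate value theorem yields a value strictly between the end values and
    outside the finite list. *)
Lemma finite_valued_path (f : R -> R) (s : seq R) : continuous f ->
  (forall t, 0 <= t <= 1 -> f t \in s) -> f 0 = f 1.
Proof.
move=> cf fs; apply: contrapT => /eqP; rewrite neq_lt => /orP[] /(avoid_finite s).
  move=> [c cab cs]; have [||t t01 ftc] := @IVT _ f 0 1 c ler01.
  - exact: continuous_subspaceT.
  - by rewrite ge_min le_max; lra.
  by move: cs; rewrite -ftc fs//; move: t01; rewrite in_itv.
move=> [c cab cs]; have [||t t01 ftc] := @IVT _ f 0 1 c ler01.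
- exact: continuous_subspaceT.
- by rewrite ge_min le_max; lra.
by move: cs; rewrite -ftc fs//; move: t01; rewrite in_itv.
Qed.

End FiniteElements.

(** * Continuous piecewise affine functions *)

Section CourantSpace.
Context {R : realType}.
Local Notation F := (pt R -> R^o).
Variables (Omega : set (pt R)) (n : nat) (Th : mesh R n).
Hypotheses (oOmega : open Omega) (hTh : is_mesh Omega Th).
Implicit Types (x y : pt R) (u v : F) (W : set F).
Local Notation V := (Vh Omega Th).

Let ndT k : nondegenerate (Th k).
Proof. by case: hTh. Qed.

Lemma closure_mesh x : closure Omega x -> exists k, hull (Th k) x.
Proof. by case: hTh => _ -> _ _ [k _]; exists k. Qed.

(** The closure of [Omega] and the complement of [Omega] are closed and cover the plane, and [v] is
    continuous on the first and zero on the second. *)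
Lemma Vh_continuous v : V v -> continuous v.
Proof.
move=> [cv _ v0].
have : {within closure Omega `|` ~` Omega, continuous v}.
  apply: withinU_continuous => //; [exact: closed_closure|exact: open_closedC|].
  apply: (@subspace_eq_continuous _ _ _ (cst 0)); last first.
    by apply: continuous_subspaceT; exact: cst_continuous.
  by move=> x; rewrite inE => /v0 vx; exact/esym.
have -> : closure Omega `|` ~` Omega = setT.
  apply/seteqP; split=> // x _; have [Ox|] := pselect (Omega x); last by right.
  by left; exact: subset_closure.
by rewrite continuous_open_subspace; [move=> h x; apply: h; rewrite inE|exact: openT].
Qed.

Lemma Vh_linear : linear_set (V : set F).
Proof.
split=> [|a u v [cu au u0] [cv av v0]].
  split=> //; first by apply: continuous_subspaceT; exact: cst_continuous.
  by move=> k; exists 0, 0, 0 => x _; rewrite !mul0r !addr0.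
split=> [x|k|x xO].
- by apply: cvgD; [apply: cvgZl_tmp; exact: cu|exact: cv].
- have [a1 [b1 [c1 h1]]] := au k; have [a2 [b2 [c2 h2]]] := av k.
  exists (a * a1 + a2), (a * b1 + b2), (a * c1 + c2) => x xK.
  by rewrite !fctE h1// h2// /GRing.scale /=; ring.
- by rewrite !fctE u0// v0// scaler0 addr0.
Qed.

Lemma affine_on_hull K v : affine_on (hull K) v -> nondegenerate K ->
  forall w : 'I_3 -> R, (forall i, 0 <= w i) -> \sum_i w i = 1 ->
  v (\sum_i w i *: K i) = \sum_i w i * v (K i).
Proof.
move=> [a [b [c vE]]] ndK w w0 w1; rewrite vE ?affine_comb//; last by exists w.
by apply: eq_bigr => i _; rewrite vE//; exact: hull_vertex.
Qed.

Lemma Vh_bounded v : V v -> exists C : R, forall x, `|v x| <= C.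
Proof.
move=> [_ av v0]; exists (\sum_k \sum_j `|v (Th k j)|) => x.
have [Ox|/v0->] := pselect (Omega x); last first.
  by rewrite normr0; apply: sumr_ge0 => k _; exact: sumr_ge0.
have [k [w [w0 w1 ->]]] := closure_mesh (subset_closure Ox).
rewrite (affine_on_hull (av k))// (bigD1 k)//= ler_wpDr//.
  by apply: sumr_ge0 => l _; exact: sumr_ge0.
apply: le_trans (ler_norm_sum _ _ _) _; apply: ler_sum => j _.
rewrite normrM ler_piMl// ger0_norm// -w1 (bigD1 j)//= ler_wpDr//.
by apply: sumr_ge0.
Qed.

Lemma Vh_nodal v : V v -> (forall k j, v (Th k j) = 0) -> v = 0.
Proof.
move=> [_ av v0] vT; apply/funext => x.
have [Ox|/v0->//] := pselect (Omega x).
have [k [w [w0 w1 ->]]] := closure_mesh (subset_closure Ox).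
by rewrite (affine_on_hull (av k))// big1// => j _; rewrite vT mulr0.
Qed.

(** The finitely many evaluations at vertices, indexed by triangle and local vertex, separate the
    functions of [V]. *)
Lemma Vh_subspace_span W : linear_set W -> W `<=` V ->
  exists s, W = lin_span s.
Proof.
move=> lW WV.
apply: (@separated_span R F _ (fun p v => v (Th p.1 p.2)) (enum {: 'I_n * 'I_3})).
- exact: lW.
- by [].
- move=> v Wv h; apply: Vh_nodal => [|k j]; first exact: WV.
  by apply: (h (k, j)); rewrite mem_enum.
Qed.

Lemma Vh_grad v k : V v -> exists g : 'cV[R]_2,
  (forall x, interior (hull (Th k)) x -> grad v x = g) /\
  (g = 0 -> forall x, hull (Th k) x -> v x = v (Th k 0)).
Proof.
move=> [_ av _]; have [a [b [c vE]]] := av k.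
exists (\col_(i < 2) (if i == 0 then b else c)); split=> [x xK|/colP g0 x xK].
  by apply: grad_affine; apply: filterS xK => y yK; exact: vE.
have := g0 0; have := g0 1; rewrite !mxE /= => c0 b0.
by rewrite !vE ?b0 ?c0 ?mul0r//; exact: hull_vertex.
Qed.

Lemma Vh_gradD a u v k x : V u -> V v -> interior (hull (Th k)) x ->
  grad (a *: u + v) x = a *: grad u x + grad v x.
Proof.
move=> [_ au _] [_ av _] xK.
have [a1 [b1 [c1 h1]]] := au k; have [a2 [b2 [c2 h2]]] := av k.
rewrite (grad_affine (v := u) (a := a1) (b := b1) (c := c1)); last first.
  by apply: filterS xK => y yK; exact: h1.
rewrite (grad_affine (v := v) (a := a2) (b := b2) (c := c2)); last first.
  by apply: filterS xK => y yK; exact: h2.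
rewrite (grad_affine (a := a * a1 + a2) (b := a * b1 + b2) (c := a * c1 + c2)).
  by apply/colP => i; rewrite !mxE; case: ifP.
by apply: filterS xK => y yK; rewrite !fctE h1// h2// /GRing.scale /=; ring.
Qed.

Lemma Vh_path_constant v x y (s : seq R) : V v ->
  (forall t : R, 0 <= t <= 1 -> v ((1 - t) *: x + t *: y) \in s) -> v x = v y.
Proof.
move=> Vv vs; have := @finite_valued_path R (fun t => v ((1 - t) *: x + t *: y)) s.
rewrite subr0 scale1r scale0r addr0 subrr scale0r add0r scale1r; apply=> // t.
apply: (@continuous_comp _ _ _ (fun t : R => (1 - t) *: x + t *: y) v).
  exact: segment_continuous.
exact: Vh_continuous.
Qed.

(** On the segment from any point to the outside point [y], the values of [v] are 0 or one of the
    finitely many triangle constants, so [v] does not change along it. *)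
Lemma Vh_locally_constant v y : V v -> ~ Omega y ->
  (forall k x, hull (Th k) x -> v x = v (Th k 0)) -> v = 0.
Proof.
move=> Vv nOy vc; apply/funext => x; have [_ _ v0] := Vv.
rewrite (@Vh_path_constant v x y (0 :: [seq v (Th k 0) | k <- enum 'I_n]))// => [|t _].
  exact: v0.
have [Oz|/v0->] := pselect (Omega ((1 - t) *: x + t *: y)); last by rewrite mem_head.
have [k /vc ->] := closure_mesh (subset_closure Oz).
by rewrite inE; apply/orP; right; apply: map_f; rewrite mem_enum.
Qed.

(** * Fine triangles inside a coarse element *)

Section CoarseElement.
Variables (N : nat) (TH : mesh R N).
Hypotheses (hTH : is_mesh Omega TH) (href : refines Th TH).

(** Refinement puts the fine triangle in some coarse one, which must be [TH i] because their
    interiors meet. *)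
Lemma fine_in_coarse i k y : interior (hull (TH i)) y -> hull (Th k) y ->
  hull (Th k) `<=` hull (TH i).
Proof.
move=> yi yk; have [j kj] := href.1 k.
have [z [zi zk]] := hull_meets_interior (@ndT k) yk (open_interior _) yi.
suff -> : i = j by [].
apply: (disjoint_elements hTH zi); exact: (interiorS kj).
Qed.

Lemma fine_interior_in_coarse k : exists i,
  interior (hull (Th k)) `<=` interior (hull (TH i)).
Proof. by have [i ki] := href.1 k; exists i; exact: interiorS. Qed.

(** The segment from [x] to the vertex [TH i 0] stays in the interior of the element until its
    endpoint, so [v] takes finitely many values along it and is constant. *)
Lemma Vh_element_constant v i x : V v -> v (TH i 0) = 0 ->
  (forall k, hull (Th k) `<=` hull (TH i) ->
     forall x, hull (Th k) x -> v x = v (Th k 0)) ->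
  interior (hull (TH i)) x -> v x = 0.
Proof.
move=> Vv vT vc xi; have ndH : nondegenerate (TH i) by case: hTH.
rewrite -vT; apply: (@Vh_path_constant v x (TH i 0)
  (0 :: [seq v (Th k 0) | k <- enum 'I_n])) => // t /andP[t0].
rewrite le_eqVlt => /predU1P[->|t1].
  by rewrite subrr scale0r add0r scale1r vT mem_head.
have zi : interior (hull (TH i)) ((1 - t) *: x + t *: TH i 0).
  by apply: interior_hull_segment => //; rewrite t0.
have [k zk] : exists k, hull (Th k) ((1 - t) *: x + t *: TH i 0).
  apply: closure_mesh; case: hTH => _ -> _ _; exists i => //.
  exact: interior_subset.
rewrite (vc k (fine_in_coarse zi zk))// inE; apply/orP; right.
by apply: map_f; rewrite mem_enum.
Qed.

End CoarseElement.

End CourantSpace.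

(** * Square roots of positive definite matrices *)

Section SquareRoot.
Context {R : realType}.
Implicit Types (M : 'M[R]_2) (x y : 'cV[R]_2).

Lemma dotvE x y : dotv x y = x 0 0 * y 0 0 + x 1 0 * y 1 0.
Proof.
rewrite /dotv mxE !big_ord_recl big_ord0 addr0 !mxE.
by have -> : lift ord0 ord0 = 1 :> 'I_2 by exact: val_inj.
Qed.

Lemma mulmx2E M x i : (M *m x) i 0 = M i 0 * x 0 0 + M i 1 * x 1 0.
Proof.
rewrite mxE !big_ord_recl big_ord0 addr0.
by have -> : lift ord0 ord0 = 1 :> 'I_2 by exact: val_inj.
Qed.

Lemma dotv_ge0 x : 0 <= dotv x x.
Proof. by rewrite dotvE addr_ge0// -expr2 sqr_ge0. Qed.

Lemma ord2P (i : 'I_2) : i = 0 \/ i = 1.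
Proof. by case: i => -[|[|//]] i2; [left|right]; exact: val_inj. Qed.

Lemma dotv_gt0 x : x != 0 -> 0 < dotv x x.
Proof.
apply: contraNT; rewrite -leNgt dotvE => h.
have h0 := sqr_ge0 (x 0 0); have h1 := sqr_ge0 (x 1 0).
apply/eqP/colP => i; rewrite mxE; apply/eqP; rewrite -sqrf_eq0; apply/eqP.
by case: (ord2P i) => ->; lra.
Qed.

Lemma dotvC x y : dotv x y = dotv y x.
Proof. by rewrite !dotvE; ring. Qed.

Lemma dotvDr a x y z : dotv z (a *: x + y) = a * dotv z x + dotv z y.
Proof. by rewrite !dotvE !mxE; ring. Qed.

Lemma dotv_mulmx_sym M x y : M^T = M -> dotv (M *m x) y = dotv (M *m y) x.
Proof.
by move=> Ms; rewrite dotvC /dotv trmx_mul Ms -mulmxA.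
Qed.

Section Definite.
Variables (M : 'M[R]_2) (c : R).
Hypotheses (c0 : 0 < c) (Ms : M^T = M).
Hypothesis Mc : forall x, c * dotv x x <= dotv (M *m x) x.

Let M10 : M 1 0 = M 0 1. Proof. by rewrite -[in LHS]Ms mxE. Qed.

(* By Cayley-Hamilton, (M + s I)^2 = (tr M + 2 s) M when s^2 = det M. *)
Lemma psd_sqrt_exists : exists S : 'M[R]_2,
  [/\ S^T = S, forall x, 0 <= dotv (S *m x) x & S *m S = M].
Proof.
have M00 : 0 < M 0 0.
  have := Mc (\col_i (i == 0)%:R); rewrite !dotvE !mulmx2E !mxE /=.
  by rewrite !(mulr0, mulr1, addr0, add0r); exact: lt_le_trans.
have M11 : 0 < M 1 1.
  have := Mc (\col_i (i == 1)%:R); rewrite !dotvE !mulmx2E !mxE /=.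
  by rewrite !(mulr0, mulr1, addr0, add0r); exact: lt_le_trans.
(* At the vector [(- M 0 1, M 0 0)] the quadratic form equals [M 0 0] times the determinant. *)
have det0 : 0 < M 0 0 * M 1 1 - M 0 1 ^+ 2.
  have := Mc (\col_i (if i == 0 then - M 0 1 else M 0 0)).
  rewrite !dotvE !mulmx2E !mxE /= M10 => h.
  have hh : 0 < c * (M 0 0 * M 0 0) by rewrite !mulr_gt0.
  have h2 : 0 <= c * (M 0 1 * M 0 1) by rewrite mulr_ge0 ?(ltW c0)// -expr2 sqr_ge0.
  have : 0 < M 0 0 * (M 0 0 * M 1 1 - M 0 1 ^+ 2) by nra.
  by rewrite pmulr_rgt0.
pose s := Num.sqrt (M 0 0 * M 1 1 - M 0 1 ^+ 2).
have s2 : s ^+ 2 = M 0 0 * M 1 1 - M 0 1 ^+ 2 by rewrite sqr_sqrtr// ltW.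
have s0 : 0 < s by rewrite sqrtr_gt0.
pose t := Num.sqrt (M 0 0 + M 1 1 + 2 * s).
have tr0 : 0 < M 0 0 + M 1 1 + 2 * s by lra.
have t2 : t ^+ 2 = M 0 0 + M 1 1 + 2 * s by rewrite sqr_sqrtr// ltW.
have t0 : t != 0 by rewrite gt_eqF// sqrtr_gt0.
exists (t^-1 *: (M + s%:M)); split.
- by rewrite linearZ /= linearD /= Ms tr_scalar_mx.
- move=> x; rewrite -scalemxAl mulmxDl mul_scalar_mx.
  have -> : dotv (t^-1 *: (M *m x + s *: x)) x =
      t^-1 * (dotv (M *m x) x + s * dotv x x).
    by move: (M *m x) => y; rewrite !dotvE !mxE; ring.
  rewrite mulr_ge0 ?invr_ge0 ?sqrtr_ge0// addr_ge0//.
    by apply: le_trans (Mc x); rewrite mulr_ge0 ?dotv_ge0// ltW.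
  by rewrite mulr_ge0 ?dotv_ge0// ltW.
- rewrite -scalemxAl -scalemxAr scalerA.
  have -> : (M + s%:M) *m (M + s%:M) = t ^+ 2 *: M.
    apply/matrixP => i j; rewrite t2 [RHS]mxE mxE !big_ord_recl big_ord0 addr0.
    have -> : lift ord0 ord0 = 1 :> 'I_2 by exact: val_inj.
    rewrite !mxE.
    by case: (ord2P i) => ->; case: (ord2P j) => ->; rewrite /= ?M10; nra.
  by rewrite scalerA -expr2 -exprMn mulVf// expr1n scale1r.
Qed.

(** Symmetry moves one factor of the chosen root across the product, and its square is [M]. *)
Lemma dotv_sqrtmx x : dotv (sqrtmx M *m x) (sqrtmx M *m x) = dotv (M *m x) x.
Proof.
have [Ss _ SS] := xgetPex (0 : 'M[R]_2) psd_sqrt_exists.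
rewrite -/(sqrtmx M) in Ss SS.
by rewrite dotv_mulmx_sym// mulmxA SS.
Qed.

End Definite.

End SquareRoot.

(** * The energy form *)

Section BoundedMeasurable.
Context {R : realType}.
Local Notation mu := (leb2 R).
Variable G : set (mpt R).
Hypotheses (mG : measurable G) (finG : (mu G < +oo)%E).

Definition bounded_measurable (f : pt R -> R) : Prop :=
  measurable_fun G f /\ exists C : R, forall x, G x -> `|f x| <= C.

Lemma bounded_measurableD f g : bounded_measurable f -> bounded_measurable g ->
  bounded_measurable (fun x => f x + g x).
Proof.
move=> [mf [C hC]] [mg [D hD]]; split; first exact: measurable_funD.
exists (C + D) => x Gx; apply: le_trans (ler_normD _ _) _.
by rewrite lerD ?hC ?hD.
Qed.

Lemma bounded_measurableM f g : bounded_measurable f -> bounded_measurable g ->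
  bounded_measurable (fun x => f x * g x).
Proof.
move=> [mf [C hC]] [mg [D hD]]; split; first exact: measurable_funM.
by exists (C * D) => x Gx; rewrite normrM ler_pM ?hC ?hD.
Qed.

Lemma bounded_measurable_integrable f : bounded_measurable f ->
  mu.-integrable G (EFin \o f).
Proof.
move=> [mf [C hC]]; apply: measurable_bounded_integrable => //.
exists C; split; first exact: num_real.
by move=> M CM x Gx /=; rewrite (le_trans (hC x Gx))// ltW.
Qed.

Lemma piecewise_constant_bounded_measurable (I : finType) (U : I -> set (mpt R))
    (c : I -> R) f : (forall i, measurable (U i)) ->
  (forall x, G x -> exists i, U i x) -> (forall i x, U i x -> f x = c i) ->
  bounded_measurable f.
Proof.
move=> mU GU fc; split.
  move=> _ Y mY; have -> : G `&` f @^-1` Y =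
      \bigcup_(i in [set i | Y (c i)]) (G `&` U i).
    apply/seteqP; split=> x /=.
      by move=> [Gx Yx]; have [i Ui] := GU x Gx; exists i; rewrite //= -(fc i x).
    by move=> [i /= Yi [Gx Ui]]; split=> //; rewrite /= (fc i).
  rewrite bigcup_mkcond; apply: countable_bigcupT_measurable => //.
  by move=> i; case: ifP => _ //; exact: measurableI.
exists (\sum_i `|c i|) => x /GU [i Ui]; rewrite (fc i)// (bigD1 i)//= ler_wpDr//.
exact: sumr_ge0.
Qed.

End BoundedMeasurable.

Section Forms.
Context {R : realType}.
Local Notation mu := (leb2 R).
Local Notation F := (pt R -> R^o).

(** At every point of [G] the coefficient bounds hold and gradients are those of a fine triangle.
    The rest of [Omega] lies in a measurable null set, as the exchange of integration domains
    requires. *)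
Record regular_part (Omega : set (pt R)) (A : pt R -> 'M[R]_2) (rho : pt R -> R)
    n (Th : mesh R n) (amin rmin rmax : R) (G : set (mpt R)) : Prop := {
  regular_measurable : measurable G;
  regular_sub : G `<=` Omega;
  regular_conull : exists Z : set (mpt R),
    [/\ measurable Z, mu Z = 0%E & Omega `\` G `<=` Z];
  regular_finite : (mu G < +oo)%E;
  regular_interior : forall x, G x -> exists k, interior (hull (Th k)) x;
  regular_coef : forall i j, bounded_measurable G (fun x => A x i j);
  regular_sym : forall x, G x -> (A x)^T = A x;
  regular_amin : 0 < amin;
  regular_coercive : forall x (v : 'cV[R]_2), G x ->
    amin * dotv v v <= dotv (A x *m v) v;
  regular_rho : measurable_fun G rho;
  regular_rmin : 0 < rmin;
  regular_weight : forall x, G x -> rmin <= rho x <= rmax }.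

Variables (Omega : set (pt R)) (A : pt R -> 'M[R]_2) (rho : pt R -> R).
Variables (n : nat) (Th : mesh R n) (amin rmin rmax : R) (G : set (mpt R)).
Hypotheses (oOmega : open Omega) (hTh : is_mesh Omega Th).
Hypothesis (rG : regular_part Omega A rho Th amin rmin rmax G).
Local Notation V := (Vh Omega Th).
Implicit Types (u v : F) (D : set (pt R)).

Let mG := regular_measurable rG.
Let finG := regular_finite rG.

Lemma Rintegral_regular D (f : pt R -> R) : D `<=` Omega ->
  \int[mu]_(x in D) f x = \int[mu]_(x in D `&` G) f x.
Proof.
move=> DO; have [Z [mZ Z0 OGZ]] := regular_conull rG.
apply: (Rintegral_setI_off_null mZ Z0) => x [Dx Gx]; apply: OGZ; split=> //.
exact: DO.
Qed.

Lemma grad_bounded_measurable v i : V v -> bounded_measurable G (fun x => grad v x i 0).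
Proof.
move=> Vv; have /choice[g hg] := fun k => Vh_grad hTh k Vv.
apply: (@piecewise_constant_bounded_measurable _ _ mG _
  (fun k => interior (hull (Th k))) (fun k => g k i 0)).
- by move=> k; apply: measurable_open2; exact: open_interior.
- exact: (regular_interior rG).
- by move=> k x xk; rewrite (hg k).1.
Qed.

Local Notation dens u v := (fun x => dotv (A x *m grad u x) (grad v x)).

Lemma dens_bounded_measurable u v : V u -> V v -> bounded_measurable G (dens u v).
Proof.
move=> Vu Vv.
rewrite (_ : dens u v = fun x =>
    (A x 0 0 * grad u x 0 0 + A x 0 1 * grad u x 1 0) * grad v x 0 0 +
    (A x 1 0 * grad u x 0 0 + A x 1 1 * grad u x 1 0) * grad v x 1 0); last first.
  by apply/funext => x; rewrite dotvE !mulmx2E.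
have b i j : bounded_measurable G (fun x => A x i j) by exact: (regular_coef rG).
have gu i := grad_bounded_measurable i Vu.
have gv i := grad_bounded_measurable i Vv.
by apply: bounded_measurableD; apply: bounded_measurableM => //;
  apply: bounded_measurableD; exact: bounded_measurableM.
Qed.

Lemma dens_integrable D u v : measurable (D : set (mpt R)) -> V u -> V v ->
  mu.-integrable (D `&` G) (EFin \o dens u v).
Proof.
move=> mD Vu Vv.
have := bounded_measurable_integrable mG finG (dens_bounded_measurable Vu Vv).
by apply: integrableS => //; exact: measurableI.
Qed.

Lemma dens_linear a u v w x : V u -> V v -> G x ->
  dens (a *: u + v) w x = a * dens u w x + dens v w x.
Proof.
move=> Vu Vv /(regular_interior rG) [k xk]; rewrite (Vh_gradD _ Vu Vv xk).
by rewrite mulmxDr -scalemxAr dotvC dotvDr !(dotvC (grad w x)).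
Qed.

Lemma energy_semi_inner D : measurable (D : set (mpt R)) -> D `<=` Omega ->
  semi_inner (V : set F) (energy D A).
Proof.
move=> mD DO; have mDG : measurable (D `&` G : set (mpt R)) by exact: measurableI.
split=> [a u v w Vu Vv Vw|u v Vu Vv|u Vu]; rewrite /energy !(Rintegral_regular _ DO).
- transitivity (\int[mu]_(x in D `&` G) (a * dens u w x + dens v w x)).
    by apply: eq_Rintegral => x /set_mem [_ Gx]; exact: dens_linear.
  rewrite RintegralD//; last exact: dens_integrable.
    by rewrite RintegralZl//; exact: dens_integrable.
  by have := integrableZl mDG a (dens_integrable mD Vu Vw).
- apply: eq_Rintegral => x /set_mem [_ Gx].
  by rewrite dotv_mulmx_sym//; exact: (regular_sym rG).
- apply: Rintegral_ge0 => x [_ Gx]; apply: le_trans (regular_coercive rG _ Gx).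
  by rewrite mulr_ge0 ?dotv_ge0// ltW// (regular_amin rG).
Qed.

Lemma seminormH1E D v : D `<=` Omega ->
  seminormH1 D A v = Num.sqrt (energy D A v v).
Proof.
move=> DO; rewrite /seminormH1 /energy !(Rintegral_regular _ DO); congr Num.sqrt.
apply: eq_Rintegral => x /set_mem [_ Gx].
apply: (dotv_sqrtmx (regular_amin rG) (regular_sym rG Gx)) => y.
exact: (regular_coercive rG).
Qed.

Lemma leb2_regular_gt0 D : open D -> D !=set0 -> D `<=` Omega ->
  (0 < mu (D `&` G))%E.
Proof.
move=> oD D0 DO; apply: lt_le_trans (leb2_open_gt0 oD D0) _.
have [Z [mZ Z0 OGZ]] := regular_conull rG.
have mD := measurable_open2 oD.
apply: (@le_trans _ _ (mu ((D `&` G) `|` Z))).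
  apply: le_measure; rewrite ?inE//.
    by apply: measurableU => //; exact: measurableI.
  move=> x Dx; have [Gx|nGx] := pselect (G x); first by left.
  by right; apply: OGZ; split=> //; exact: DO.
have mDG : measurable (D `&` G : set (mpt R)) by exact: measurableI.
have le : (mu ((D `&` G) `|` Z) <= mu (D `&` G) + mu Z)%E by exact: measureU2.
by rewrite (le_trans le)// Z0 adde0.
Qed.

(** If the constant gradient [g] on the triangle were nonzero, coercivity would bound the energy
    below by [amin |g|^2] times the positive measure of the regular part of the triangle. *)
Lemma energy_eq0 D v k : measurable (D : set (mpt R)) -> D `<=` Omega ->
  interior (hull (Th k)) `<=` D -> V v -> energy D A v v = 0 ->
  forall x, hull (Th k) x -> v x = v (Th k 0).
Proof.
move=> mD DO kD Vv e0; have [g [gE g0]] := Vh_grad hTh k Vv.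
apply: g0; apply: contrapT => /eqP gn0.
pose U := interior (hull (Th k)); have oU : open U by exact: open_interior.
have mU := measurable_open2 oU.
have mDG : measurable (D `&` G : set (mpt R)) by exact: measurableI.
have c0 : 0 < amin * dotv g g by rewrite mulr_gt0 ?dotv_gt0// (regular_amin rG).
have U0 : U !=set0 by apply: interior_hull_neq0; case: hTh.
have UO : U `<=` Omega by move=> x /kD /DO.
have := leb2_regular_gt0 oU U0 UO.
have finU : (mu (U `&` G) < +oo)%E.
  apply: le_lt_trans finG; apply: le_measure; rewrite ?inE//.
  exact: measurableI.
rewrite -(@fineK _ (mu (U `&` G))) ?ge0_fin_numE// lte_fin => mu0.
suff : amin * dotv g g * fine (mu (U `&` G)) <= energy D A v v.
  by rewrite e0 leNgt mulr_gt0.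
have mUG : measurable (U `&` G : set (mpt R)) by exact: measurableI.
have UE : U `&` G = (D `&` G) `&` U.
  by apply/seteqP; split=> x [] => [xU Gx|[Dx Gx] xU]; do ?split => //; exact: kD.
(* The lower bound becomes the integral over [D] of a constant cut off outside the triangle, to be
   compared pointwise with the energy density. *)
rewrite -Rintegral_cst// UE Rintegral_mkcondr /energy (Rintegral_regular _ DO).
apply: le_Rintegral => //.
- rewrite -restrict_EFin; apply: (iffLR (integrable_restrict _ mU mDG _)).
  apply: measurable_bounded_integrable; first exact: measurableI.
  + apply: le_lt_trans finG; apply: le_measure; rewrite ?inE//.
      by do 2 apply: measurableI => //.
    by move=> x [[_ Gx] _].
  + exact: measurable_cst.
  + exists (amin * dotv g g); split; first exact: num_real.
    by move=> M CM x _ /=; rewrite ger0_norm ltW.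
- exact: dens_integrable.
- move=> x [_ Gx]; rewrite patchE; case: ifPn => [/set_mem xU|_].
    by rewrite gE//; exact: (regular_coercive rG).
  apply: le_trans (regular_coercive rG _ Gx).
  by rewrite mulr_ge0 ?dotv_ge0// ltW// (regular_amin rG).
Qed.

End Forms.

(** * The weighted L2 form *)

Section WeightedForm.
Context {R : realType}.
Local Notation mu := (leb2 R).
Local Notation F := (pt R -> R^o).
Variables (Omega : set (pt R)) (A : pt R -> 'M[R]_2) (rho : pt R -> R).
Variables (n : nat) (Th : mesh R n) (amin rmin rmax : R) (G : set (mpt R)).
Hypotheses (oOmega : open Omega) (hTh : is_mesh Omega Th).
Hypothesis (rG : regular_part Omega A rho Th amin rmin rmax G).
Local Notation V := (Vh Omega Th).
Implicit Types (u v w : F) (D : set (pt R)).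

Let mG := regular_measurable rG.
Let finG := regular_finite rG.

(** The integral is taken over the regular part of [D], where the bounds on [rho] hold pointwise;
    for [D] inside [Omega] the value is that over [D]. *)
Definition weighted_form D u w : R := \int[mu]_(x in D `&` G) (rho x * u x * w x).

(** A common space for the datum [g] and the finite element functions, in which Cauchy-Schwarz is
    applied. *)
Definition square_integrable : set F :=
  [set u : pt R -> R | measurable_fun G u /\ mu.-integrable G (fun x => (u x ^+ 2)%:E)].

(** The product is dominated by [u^2 + w^2]. *)
Lemma square_integrable_mul u w : square_integrable u -> square_integrable w ->
  mu.-integrable G (fun x => (u x * w x)%:E).
Proof.
move=> [mu2 iu] [mw iw].
apply: (le_integrable mG _ _ (integrableD mG iu iw)).
  by apply/measurable_EFinP; exact: measurable_funM.
move=> x _; rewrite -EFinD !abse_EFin lee_fin.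
rewrite [leRHS]ger0_norm ?addr_ge0 ?sqr_ge0// ler_norml; apply/andP.
have := sqr_ge0 (u x + w x); have := sqr_ge0 (u x - w x).
have := sqr_ge0 (u x); have := sqr_ge0 (w x).
by split; nra.
Qed.

Lemma square_integrable_linear : linear_set square_integrable.
Proof.
split=> [|a u v uL vL].
  split; first exact: measurable_cst.
  rewrite (_ : (fun _ => _) = cst 0%E); first exact: integrable0.
  by apply/funext => x; rewrite /= expr0n.
have [[mu2 iu] [mv iv]] := (uL, vL); split.
  by apply: measurable_funD => //; apply: measurable_funM => //; exact: measurable_cst.
rewrite (_ : (fun _ => _) = (fun x => (a ^+ 2)%:E * (u x ^+ 2)%:E)
   \+ ((fun x => (2 * a)%:E * (u x * v x)%:E) \+ (fun x => (v x ^+ 2)%:E)))%E.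
  apply: integrableD => //; first exact: integrableZl.
  apply: integrableD => //; apply: integrableZl => //.
  exact: square_integrable_mul.
apply/funext => x /=; rewrite -!EFinM -!EFinD; congr EFin.
by rewrite !fctE /GRing.scale /=; ring.
Qed.

Lemma weighted_integrable D u w : measurable (D : set (mpt R)) ->
  square_integrable u -> square_integrable w ->
  mu.-integrable (D `&` G) (EFin \o (fun x => rho x * u x * w x)).
Proof.
move=> mD uL wL; have [[mu2 iu] [mw iw]] := (uL, wL).
suff : mu.-integrable G (EFin \o (fun x => rho x * u x * w x)).
  by apply: integrableS => //; exact: measurableI.
have i0 := integrableZl mG rmax (square_integrable_mul uL wL).
apply: (le_integrable mG _ _ i0).
  apply/measurable_EFinP; apply: measurable_funM => //.
  by apply: measurable_funM => //; exact: (regular_rho rG).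
move=> x Gx /=; rewrite lee_fin -mulrA !normrM.
have /andP[h1 h2] := regular_weight rG Gx; have h3 := regular_rmin rG.
by rewrite ler_wpM2r ?mulr_ge0// !ger0_norm//; lra.
Qed.

Lemma weighted_semi_inner D : measurable (D : set (mpt R)) ->
  semi_inner square_integrable (weighted_form D).
Proof.
move=> mD; have mDG : measurable (D `&` G : set (mpt R)) by exact: measurableI.
split=> [a u v w uL vL wL|u v uL vL|u uL]; rewrite /weighted_form.
- transitivity (\int[mu]_(x in D `&` G)
      (a * (rho x * u x * w x) + rho x * v x * w x)).
    by apply: eq_Rintegral => x _; rewrite !fctE /GRing.scale /=; ring.
  rewrite RintegralD//; last exact: weighted_integrable.
    by rewrite RintegralZl//; exact: weighted_integrable.
  by have := integrableZl mDG a (weighted_integrable mD uL wL).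
- by apply: eq_Rintegral => x _; ring.
- apply: Rintegral_ge0 => x [_ Gx]; rewrite -mulrA -expr2 mulr_ge0 ?sqr_ge0//.
  by have := regular_weight rG Gx; have := regular_rmin rG; lra.
Qed.

Lemma Vh_square_integrable v : V v -> square_integrable v.
Proof.
move=> Vv; have mv : measurable_fun (G : set (mpt R)) v.
  apply: (@measurable_funS _ _ _ _ setT) => //.
  by apply: measurable_continuous2; exact: (Vh_continuous oOmega Vv).
split=> //; have [C hC] := Vh_bounded hTh Vv.
have bv : bounded_measurable G v by split=> //; exists C.
have := bounded_measurable_integrable mG finG (bounded_measurableM bv bv).
by under eq_fun do rewrite /= -expr2.
Qed.

(** Since [rho >= rmin > 0], the square of [g] is dominated by [f^2 / rmin^2]. *)
Lemma L2_square_integrable f g : L2 Omega f -> mfun_on Omega g ->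
  (forall x, G x -> f x = rho x * g x) -> square_integrable g.
Proof.
move=> [mf if2] mg fg; have mO := measurable_open2 oOmega.
have mgG : measurable_fun G g by exact: (measurable_funS mO (regular_sub rG) mg).
split=> //.
have ifG : mu.-integrable G (fun x => (f x ^+ 2)%:E).
  by apply: integrableS if2 => //; exact: (regular_sub rG).
have i0 := integrableZl mG (rmin ^- 2) ifG.
apply: (le_integrable mG _ _ i0).
  by apply/measurable_EFinP; exact: measurable_funX.
move=> x Gx /=; rewrite lee_fin fg// exprMn.
have r0 := regular_rmin rG; have /andP[r1 _] := regular_weight rG Gx.
rewrite [leLHS]ger0_norm ?sqr_ge0//; apply: le_trans (ler_norm _).
rewrite mulrA ler_peMl ?sqr_ge0// mulrC ler_pdivlMr ?exprn_gt0// mul1r.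
by rewrite ler_sqr ?nnegrE; lra.
Qed.

Lemma normL2wE D u : D `<=` Omega ->
  normL2w D rho u = Num.sqrt (weighted_form D u u).
Proof.
move=> DO; rewrite /normL2w /normL2 (Rintegral_regular rG)//; congr Num.sqrt.
apply: eq_Rintegral => x /set_mem [_ Gx].
have r0 := regular_rmin rG; have /andP[r1 _] := regular_weight rG Gx.
by rewrite exprMn sqr_sqrtr ?expr2 ?mulrA//; lra.
Qed.

Lemma innerE u w : inner Omega (fun x => rho x * u x) w = weighted_form Omega u w.
Proof. exact: (Rintegral_regular rG). Qed.

(** * Splitting the forms over the coarse elements *)

Section Partition.
Variables (N : nat) (TH : mesh R N).
Hypotheses (hTH : is_mesh Omega TH) (href : refines Th TH).

Lemma elt_measurable i : measurable (elt TH i : set (mpt R)).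
Proof. by apply: measurable_open2; exact: open_interior. Qed.

Lemma elt_sub i : elt TH i `<=` Omega.
Proof. by case: hTH => _ _ + _; exact. Qed.

(** The open coarse elements are disjoint, and they cover [G] because its points are interior to
    fine triangles. *)
Let Rintegral_elements (f : pt R -> R) : mu.-integrable G (EFin \o f) ->
  \int[mu]_(x in G) f x = \sum_i \int[mu]_(x in elt TH i `&` G) f x.
Proof.
apply: Rintegral_partition => // [i|i j ij|x].
- exact: elt_measurable.
- apply/seteqP; split=> // x [xi xj]; move/eqP: ij; apply.
  exact: (disjoint_elements hTH xi xj).
- move=> /(regular_interior rG) [k xk].
  by have [i ki] := fine_interior_in_coarse href k; exists i => //; exact: ki.
Qed.

Lemma energy_elements u v : V u -> V v ->
  energy Omega A u v = \sum_i energy (elt TH i) A u v.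
Proof.
move=> Vu Vv; rewrite /energy (Rintegral_regular rG)// setIidr; last first.
  exact: (regular_sub rG).
rewrite Rintegral_elements.
  by apply: eq_bigr => i _; rewrite -(Rintegral_regular rG)//; exact: elt_sub.
have := dens_integrable hTh rG (@measurableT _ (mpt R)) Vu Vv.
by rewrite setTI.
Qed.

Lemma weighted_elements u v : square_integrable u -> square_integrable v ->
  weighted_form Omega u v = \sum_i weighted_form (elt TH i) u v.
Proof.
move=> uL vL; rewrite /weighted_form setIidr; last exact: (regular_sub rG).
rewrite Rintegral_elements//.
have := weighted_integrable (@measurableT _ (mpt R)) uL vL.
by rewrite setTI.
Qed.

End Partition.

End WeightedForm.

(** * Existence of the regular part, and of a point outside the domain *)

Section RegularPartExists.
Context {R : realType}.
Local Notation mu := (leb2 R).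

(** Finitely many almost-everywhere conditions hold simultaneously off one measurable null set,
    which is removed from [Omega]. *)
Lemma regular_part_exists (Omega : set (pt R)) (A : pt R -> 'M[R]_2)
    (rho f g : pt R -> R) (amin amax rmin rmax : R) n (Th : mesh R n) :
  open Omega -> bounded_set Omega -> is_mesh Omega Th ->
  admissible_matrix Omega A amin amax -> admissible_weight Omega rho rmin rmax ->
  {ae mu, forall x, Omega x -> f x = rho x * g x} ->
  exists G, regular_part Omega A rho Th amin rmin rmax G /\
    forall x, G x -> f x = rho x * g x.
Proof.
move=> oO bO hTh [amin0 _ LA symA eigA] [rmin0 _ [mrho _] rhoP] fg.
have /choice [M hM] : forall p : 'I_2 * 'I_2, exists M : R,
    {ae mu, forall x, Omega x -> `|A x p.1 p.2| <= M}.
  by move=> p; case: (LA p.1 p.2) => _ [M hM]; exists M.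
have {}hM := @filter_forall _ _ _ _ (ae_filter_ringOfSetsType mu) hM.
have hT := @filter_forall _ _ _ _ (ae_filter_ringOfSetsType mu)
  (fun k => ae_interior_hull (let: And4 h _ _ _ := hTh in h k)).
have mO := measurable_open2 oO.
have and_ae (P Q : set (mpt R)) : {ae mu, forall x, P x} -> {ae mu, forall x, Q x} ->
    {ae mu, forall x, P x /\ Q x}.
  exact: (@filterI _ _ (ae_filter_ringOfSetsType mu)).
have [Z [mZ Z0 sZ]] := and_ae _ _ hM (and_ae _ _ hT (and_ae _ _ symA
  (and_ae _ _ eigA (and_ae _ _ rhoP fg)))).
pose G : set (mpt R) := Omega `\` Z.
have GP x : G x -> [/\ forall p : 'I_2 * 'I_2, `|A x p.1 p.2| <= M p,
    forall k, hull (Th k) x -> interior (hull (Th k)) x, (A x)^T = A x,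
    (forall v : 'cV[R]_2, amin * dotv v v <= dotv (A x *m v) v) &
    rmin <= rho x <= rmax /\ f x = rho x * g x].
  move=> [Ox nZ].
  have := contra_notP (sZ x) nZ.
  move=> [h1 [h2 [h3 [h4 [h5 h6]]]]].
  split; [by move=> p; exact: h1|exact: h2|exact: h3| |by split; [exact: h5|exact: h6]].
  move=> v; have [am [ap [_ _ /(_ v) [e1 e2 _ _]]]] := h4 Ox.
  exact: le_trans e1 e2.
have mG : measurable G by exact: measurableD.
have GO : G `<=` Omega by move=> x [].
exists G; split; last by move=> x /GP [_ _ _ _ []].
split=> //.
- by exists Z; split=> // x [Ox]; apply: contra_notP => nZ; split.
- apply: le_lt_trans (leb2_bounded_fin oO bO).
  by apply: le_measure; rewrite ?inE.
- move=> x Gx; have [_ hi _ _ _] := GP x Gx.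
  have [k xk] := closure_mesh hTh (subset_closure (GO x Gx)).
  by exists k; exact: hi.
- move=> i j; split; last first.
    by exists (M (i, j)) => x /GP [+ _ _ _ _] => /(_ (i, j)).
  by have [mA _] := LA i j; exact: (measurable_funS mO GO mA).
- by move=> x /GP [].
- by move=> x v /GP [_ _ _ + _]; exact.
- exact: (measurable_funS mO GO mrho).
- by move=> x /GP [_ _ _ _ []].
Qed.

Lemma bounded_set_proper (D : set (pt R)) : bounded_set D -> exists y, ~ D y.
Proof.
move=> [M [_ hM]]; exists (Num.max M 0 + 1, 0) => Dy.
have MM : M <= Num.max M 0 by rewrite le_max lexx.
have M0 : 0 <= Num.max M 0 by rewrite le_max lexx orbT.
have Mm : M < Num.max M 0 + 1 / 2 by lra.
have := hM _ Mm _ Dy; rewrite /= prod_normE ge_max /= => /andP[h1 _].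
by move: h1; rewrite ger0_norm; lra.
Qed.

End RegularPartExists.

(** * Discrete harmonic functions *)

Section HarmonicSpace.
Context {R : realType}.
Local Notation mu := (leb2 R).
Local Notation F := (pt R -> R^o).
Variables (Omega : set (pt R)) (A : pt R -> 'M[R]_2) (rho : pt R -> R).
Variables (N n : nat) (TH : mesh R N) (Th : mesh R n).
Variables (amin rmin rmax : R) (G : set (mpt R)).
Hypotheses (oOmega : open Omega) (bOmega : bounded_set Omega).
Hypotheses (hTH : is_mesh Omega TH) (hTh : is_mesh Omega Th).
Hypothesis (href : refines Th TH).
Hypothesis (rG : regular_part Omega A rho Th amin rmin rmax G).
Local Notation V := (Vh Omega Th : set F).
Local Notation VB := (VhB Omega TH Th : set F).
Local Notation VH := (VhH Omega A TH Th : set F).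
Local Notation a := (energy Omega A).
Local Notation L2G := (square_integrable G : set F).
Local Notation wform := (weighted_form rho G).
Local Notation ext := (Defs.ext Omega A TH Th).
Local Notation trace := (Defs.trace TH).
Implicit Types (u v w : F).

Let mOmega := measurable_open2 oOmega.
Let lV : linear_set V := Vh_linear Omega Th.
Let sa : semi_inner V a := energy_semi_inner hTh rG mOmega (@subset_refl _ Omega).

(** Zero energy makes [v] constant on each fine triangle, and a point outside the bounded domain
    forces these constants to be 0. *)
Lemma energy_definite v : V v -> a v v = 0 -> v = 0.
Proof.
move=> Vv v0; have [y nOy] := bounded_set_proper bOmega.
apply: (Vh_locally_constant oOmega hTh Vv nOy) => k x.
apply: (energy_eq0 hTh rG mOmega _ _ Vv v0) => //.
by case: hTh => _ _ + _; exact.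
Qed.

Lemma VhB_sub : VB `<=` V. Proof. by move=> v []. Qed.

Lemma VhH_sub : VH `<=` V. Proof. by move=> v []. Qed.

Lemma VhB_linear : linear_set VB.
Proof.
split=> [|c u v [Vu u0] [Vv v0]]; first by split=> //; exact: lV.1.
split=> [|i x xi]; first exact: lV.2.
by rewrite !fctE (u0 i)// (v0 i)// scaler0 addr0.
Qed.

Lemma VhH_linear : linear_set VH.
Proof.
have [a1 a2 a3] := sa.
split=> [|c u v [Vu u0] [Vv v0]]; split.
- exact: lV.1.
- by move=> v [Vv _]; exact: (semi_inner0l lV sa Vv).
- exact: lV.2.
- move=> w Bw; have Vw : V w by exact: VhB_sub.
  by rewrite [LHS]a1// u0// v0// mulr0 addr0.
Qed.

Lemma trace_eqP u v : trace u = trace v <-> forall x, skeleton TH x -> u x = v x.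
Proof.
split=> [/funeqP uv x xS|uv].
  by have := uv x; rewrite /trace !patchE mem_set.
by apply/funext => x; rewrite /trace !patchE; case: ifPn => // /set_mem /uv.
Qed.

(** The difference is a bubble to which both functions are orthogonal, so its energy is zero. *)
Lemma harmonic_unique u v : VH u -> VH v -> trace u = trace v -> u = v.
Proof.
move=> Hu Hv /trace_eqP uv; have [Vu u0] := Hu; have [Vv v0] := Hv.
have Bw : VB (u - v).
  split=> [|i x xi]; first exact: (linear_set_sub lV).
  by rewrite !fctE uv ?subrr//; exists i.
apply/eqP; rewrite -subr_eq0; apply/eqP/energy_definite; first exact: VhB_sub.
rewrite (semi_innerBl sa)//; last exact: VhB_sub.
by rewrite u0// v0// subrr.
Qed.

(** By uniqueness the choice in [ext] inverts the trace, so questions about [Lambda] become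
    questions about harmonic functions. *)
Lemma ext_trace v : VH v -> ext (trace v) = v.
Proof.
move=> Hv; have [|Hw wv] := @xgetPex _ (cst 0)
    [set w | VhH Omega A TH Th w /\ trace w = trace v]; first by exists v.
exact: harmonic_unique.
Qed.

(** Subtracting the projection on the bubbles changes neither the skeleton values nor the energy
    product with a harmonic function. *)
Lemma bubble_projection u : V u -> exists2 w, VH w &
  trace w = trace u /\ forall v, VH v -> a w v = a u v.
Proof.
move=> Vu; have [s sE] := Vh_subspace_span hTh VhB_linear VhB_sub.
have sV : lin_span s `<=` V by rewrite -sE; exact: VhB_sub.
have [b bB hb] := span_projection lV sa sV Vu.
rewrite -sE in bB hb; have Vb := VhB_sub bB.
exists (u - b); first by split=> //; exact: (linear_set_sub lV).
split=> [|v [Vv vB]].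
  apply/trace_eqP => x [i _ xi]; rewrite !fctE; have [_ b0] := bB.
  by rewrite (b0 i)// subr0.
have [_ a2 _] := sa.
rewrite (semi_innerBl sa)// [a b v]a2// vB// subr0//.
Qed.

(** The extensions of the elements of [Lambda_tilde], described on the plane. *)
Definition VhT : set F := [set v | VH v /\ forall x, inner_nodes Omega TH x -> v x = 0].

Lemma VhT_linear : linear_set VhT.
Proof.
split=> [|c u v [Vu u0] [Vv v0]].
  by split=> //; exact: VhH_linear.1.
split=> [|x xi]; first exact: VhH_linear.2.
by rewrite !fctE u0// v0// scaler0 addr0.
Qed.

Lemma VhT_sub : VhT `<=` V. Proof. by move=> v [/VhH_sub]. Qed.

Lemma trace_inner_node v x : inner_nodes Omega TH x -> trace v x = v x.
Proof. by move=> [_ [xS _]]; rewrite /trace patchE mem_set. Qed.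

Lemma Lambda_tildeP m : Lambda_tilde Omega A TH Th m <->
  exists2 v, VhT v & trace v = m.
Proof.
split=> [[[v Hv <-] v0]|[v [Hv v0] <-]].
  by exists v => //; split=> // x xi; rewrite -(trace_inner_node v xi); exact: v0.
by split=> [|x xi]; [exists v|rewrite trace_inner_node// v0].
Qed.

Lemma s_formE u v : VH u -> VH v ->
  s_form Omega A TH Th (trace u) (trace v) = a u v.
Proof.
move=> Hu Hv; rewrite (energy_elements hTh rG hTH href (VhH_sub Hu) (VhH_sub Hv)).
by apply: eq_bigr => i _; rewrite /s_loc (ext_trace Hu) (ext_trace Hv).
Qed.

(** A vertex on the boundary is outside the open set [Omega], where [v] is zero; any other vertex is
    an inner node. *)
Lemma VhT_vertex v i : VhT v -> v (TH i 0) = 0.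
Proof.
move=> [[[_ _ v0] _] vi].
have [bd|nbd] := pselect (bdry Omega (TH i 0)).
  by apply: v0 => Ox; case: bd => _; apply; move: oOmega; rewrite openE; exact.
apply: vi; split; first by exists i, 0.
split=> //; exists i => //; exists (segment (TH i 0) (TH i 1)).
  by exists 0, 1.
by exists 0; [rewrite /= lexx ler01|rewrite subr0 scale1r scale0r addr0].
Qed.

(** A comparison of two forms on a finitely spanned space: a function of zero local energy is
    constant on the fine triangles of the element and zero at a vertex, hence zero inside. *)
Lemma local_poincare i : exists2 c : R, 0 <= c & forall v, VhT v ->
  wform (elt TH i) v v <= c * energy (elt TH i) A v v.
Proof.
have me := elt_measurable TH i; have eO := elt_sub hTH (i := i).
have [s sE] := Vh_subspace_span hTh VhT_linear VhT_sub.
have VL : V `<=` L2G by move=> v; exact: (Vh_square_integrable oOmega hTh rG).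
have sP := semi_innerS (subset_trans VhT_sub VL) (weighted_semi_inner rG me).
have sQ := semi_innerS VhT_sub (energy_semi_inner hTh rG me eO).
have [||c c0 hc] := span_domination VhT_linear sP sQ (s := s).
- by rewrite -sE.
- move=> v Tv e0; have Vv := VhT_sub Tv.
  transitivity (\int[mu]_(x in elt TH i `&` G) (0 : R)).
    apply: eq_Rintegral => x /set_mem [xe _].
    rewrite (Vh_element_constant oOmega hTh hTH href Vv _ _ xe) ?mulr0//.
      exact: VhT_vertex.
    move=> k ki; apply: (energy_eq0 hTh rG me eO _ Vv e0).
    exact: interiorS.
  by rewrite /Rintegral integral0.
by exists c => // v Tv; apply: hc; rewrite -sE.
Qed.

(** The infimum defining the local constant is itself admissible, since the inequality is preserved
    when passing to the infimum of a nonempty set. *)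
Lemma cPL_bound (H : R) i v : 0 < H -> VhT v ->
  normL2w (elt TH i) rho v <=
    cPL Omega A TH Th rho H * H * seminormH1 (elt TH i) A v.
Proof.
move=> H0 Tv; set y := seminormH1 _ _ _; set x := normL2w _ _ _.
have eO := elt_sub hTH (i := i).
pose S := [set c : R | 0 <= c /\ forall m, Lambda_tilde Omega A TH Th m ->
    normL2w (elt TH i) rho (ext m) <= c * H * seminormH1 (elt TH i) A (ext m)].
have SP c : S c -> x <= c * H * y.
  move=> [_ /(_ (trace v))]; rewrite ext_trace; last by case: Tv.
  by apply; apply/Lambda_tildeP; exists v.
have S0 : S !=set0.
  have [c c0 hc] := local_poincare i.
  (* The local inequality compares squared norms, hence the root; dividing by [H] matches the
     scaling of the constant. *)
  exists (Num.sqrt c / H); split; first by rewrite divr_ge0 ?sqrtr_ge0// ltW.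
  move=> m /Lambda_tildeP [w Tw <-]; rewrite ext_trace; last by case: Tw.
  rewrite divfK ?gt_eqF// (normL2wE rG)// (seminormH1E rG)// -sqrtrM//.
  by rewrite ler_wsqrtr// hc.
have y0 : 0 <= y by exact: sqrtr_ge0.
have iS : inf S <= cPL Omega A TH Th rho H by exact: le_bigmax.
suff le : x <= inf S * H * y.
  by apply: le_trans le _; rewrite ler_wpM2r// ler_wpM2r// ltW.
(* If the seminorm is zero, one admissible constant already gives [x <= 0]; otherwise [H * y] can be
   divided out. *)
move: y0; rewrite le_eqVlt => /predU1P[y0|y0].
  by have [c /SP] := S0; rewrite -y0 !mulr0.
rewrite -mulrA -ler_pdivrMr ?mulr_gt0//; apply: lb_le_inf => // c /SP.
by rewrite -mulrA ler_pdivrMr ?mulr_gt0.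
Qed.

End HarmonicSpace.

(** * The energy error estimate for the multiscale solution *)

Theorem theorem4 (R : realType) (Omega : set (R * R))
  (A : R * R -> 'M[R]_2) (amin amax : R)
  (rho : R * R -> R) (rhomin rhomax : R) (f g : R * R -> R)
  (N n : nat) (TH : mesh R N) (Th : mesh R n) (H h : R)
  (uh lambda_ms : R * R -> R)
  (hOmega : polygonal_domain Omega)
  (hA : admissible_matrix Omega A amin amax)
  (hrho : admissible_weight Omega rho rhomin rhomax)
  (hf : L2 Omega f)
  (hg : mfun_on Omega g)
  (hfg : {ae leb2 R, forall x, Omega x -> f x = rho x * g x})
  (hTH : is_mesh Omega TH) (hH : char_length TH H)
  (hTh : is_mesh Omega Th) (hh : char_length Th h)
  (hhH : h < H) (href : refines Th TH)
  (huh : Vh Omega Th uh)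
  (huh_sol : forall v, Vh Omega Th v ->
     energy Omega A uh v = inner Omega (fun x => rho x * g x) v)
  (hms : Lambda_ms Omega A TH Th lambda_ms)
  (hms_sol : forall mu, Lambda_ms Omega A TH Th mu ->
     s_form Omega A TH Th lambda_ms mu =
       inner Omega (fun x => rho x * g x) (ext Omega A TH Th mu)) :
  let lambda := trace TH uh in
  let uhH := ext Omega A TH Th lambda in
  let uhms := ext Omega A TH Th lambda_ms in
  Lambda_tilde Omega A TH Th (lambda \- lambda_ms) /\
  seminormH1 Omega A (uhH \- uhms)
    <= cPL Omega A TH Th rho H * H * normL2w Omega rho g.
Proof.
move=> lambda uhH uhms.
have [oO _ _ bO _] := hOmega.
have [H0 _] := hH.
have [G [rG fG]] := regular_part_exists oO bO hTh hA hrho hfg.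
have gL := L2_square_integrable oO rG hf hg fG.
have OO : Omega `<=` Omega by [].
have mO := measurable_open2 oO.
have lV := Vh_linear Omega Th.
have sa := energy_semi_inner hTh rG mO OO.
have lH := VhH_linear TH oO hTh rG.
have HV := @VhH_sub R Omega A N n TH Th.
have [p Hp [tp ap]] := bubble_projection TH oO hTh rG huh.
have [m0 Hm0 tm0] : exists2 m0, VhH Omega A TH Th m0 & trace TH m0 = lambda_ms.
  by case: hms => [[m0 Hm0 <-] _]; exists m0.
have uhHE : uhH = p by rewrite /uhH /lambda -tp (ext_trace oO bO hTh rG Hp).
have uhmsE : uhms = m0 by rewrite /uhms -tm0 (ext_trace oO bO hTh rG Hm0).
rewrite uhHE uhmsE.
pose d : pt R -> R^o := (p : pt R -> R^o) - m0.
have Hd : VhH Omega A TH Th d by exact: linear_set_sub.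
have lambdaE : lambda \- lambda_ms = trace TH d.
  apply/funext => x; rewrite /lambda -tp -tm0 /trace /= !patchE.
  by case: ifP => _ //; rewrite subrr.
have TV := @VhT_sub R Omega A N n TH Th.
have lT := VhT_linear TH oO hTh rG.
have [s sE] := Vh_subspace_span hTh lT TV.
have sV : lin_span s `<=` Vh Omega Th by rewrite -sE.
(* The decomposition of [d] along [Lambda_tilde] and [Lambda_ms]: [t] is its first component and
   [m = d - t] its second. *)
have [t Tt ht] := span_projection lV sa sV (HV _ Hd).
rewrite -sE in Tt ht.
have [b1 b2 b3] := sa.
have Ht : VhH Omega A TH Th t by case: Tt.
set m := d - t in ht.
have Hm : VhH Omega A TH Th m by exact: linear_set_sub.
have Lm : Lambda_ms Omega A TH Th (trace TH m).
  split; first by exists m.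
  move=> nu /Lambda_tildeP [w Tw <-].
  have Hw : VhH Omega A TH Th w by case: Tw.
  by rewrite (s_formE oO bO hTH hTh href rG Hm Hw); exact: ht.
have Vd := HV _ Hd; have Vm := HV _ Hm; have Vt := HV _ Ht.
have Vp := HV _ Hp; have Vm0 := HV _ Hm0.
(* Both discrete problems are tested with [m], and the right-hand sides cancel. *)
have am : energy Omega A d m = 0.
  rewrite (semi_innerBl sa Vp Vm0 Vm) (ap _ Hm) (huh_sol _ Vm).
  rewrite -(s_formE oO bO hTH hTh href rG Hm0 Hm) tm0 (hms_sol _ Lm).
  by rewrite (ext_trace oO bO hTh rG Hm) subrr.
have m0E : m = 0.
  apply: (energy_definite oO bO hTh rG Vm).
  by rewrite (semi_innerBl sa Vd Vt Vm) am (b2 _ _ Vt Vm) (ht _ Tt) subrr.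
have Td : VhT Omega A TH Th d.
  by have -> : d = t by apply/eqP; rewrite -subr_eq0 -/m m0E.
split; first by rewrite lambdaE; apply/Lambda_tildeP; exists d.
have -> : p \- m0 = d by [].
set K := cPL Omega A TH Th rho H * H.
have c0 : 0 <= cPL Omega A TH Th rho H by rewrite /cPL bigmax_idl le_max lexx.
have K0 : 0 <= K := mulr_ge0 c0 (ltW H0).
(* The multiscale part contributes nothing, because [lambda_ms] is [s]-orthogonal to the trace of
   [d]. *)
have add : energy Omega A d d = weighted_form rho G Omega g d.
  rewrite (semi_innerBl sa Vp Vm0 Vd) (ap _ Hd) (huh_sol _ Vd) (innerE rG).
  rewrite -(s_formE oO bO hTH hTh href rG Hm0 Hd) tm0.
  have [_ ->] := hms; first by rewrite subr0.
  by apply/Lambda_tildeP; exists d.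
have dL := Vh_square_integrable oO hTh rG Vd.
have lL := square_integrable_linear rG.
have ws := weighted_semi_inner rG mO.
have CS := semi_inner_CS lL ws gL dL.
(* The squared local Poincaré inequalities, summed over the elements. *)
have dd : weighted_form rho G Omega d d <= K ^+ 2 * energy Omega A d d.
  rewrite (weighted_elements rG hTH href dL dL).
  rewrite (energy_elements hTh rG hTH href Vd Vd) mulr_sumr.
  apply: ler_sum => i _; have eO := elt_sub hTH (i := i).
  have mi := elt_measurable TH i.
  have [_ _ /(_ _ dL) w0] := weighted_semi_inner rG mi.
  have [_ _ /(_ _ Vd) e0] := energy_semi_inner hTh rG mi eO.
  rewrite -(sqr_sqrtr w0) -(sqr_sqrtr e0) -exprMn -(normL2wE rG)//.
  rewrite -(seminormH1E rG)// ler_sqr ?nnegrE ?(mulr_ge0 K0) ?sqrtr_ge0//.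
  exact: (cPL_bound oO bO hTH hTh href rG).
have [_ _ ws0] := ws; have gg0 := ws0 _ gL.
rewrite (seminormH1E rG)// (normL2wE rG)// -[K]ger0_norm// -sqrtr_sqr -sqrtrM ?sqr_ge0//.
(* For positive energy, [a(d, d)^2 <= |g|^2 |d|^2 <= K^2 |g|^2 a(d, d)] in weighted norms, and one
   factor [a(d, d)] cancels. *)
apply: ler_wsqrtr; have := b3 _ Vd; rewrite le_eqVlt => /predU1P[<-|e0].
  by rewrite mulr_ge0 ?sqr_ge0.
rewrite -(ler_pM2r e0) -expr2 {1}add (le_trans CS)//.
by rewrite mulrAC [leRHS]mulrC ler_wpM2l.
Qed.
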